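(* Let $d\in\mathbb{N}$ with $d\ge 1$, and let $R$ be a $d$-ary relation symbol. There exists a first-order formula $\nu_d(x)$ over the vocabulary $\{+,<,R\}$, with one free variable $x$ (depending only on $d$ and not on the interpretation of $R$), such that for every $\{+,<,R\}$-structure $\mathcal{S}$ over $\mathbb{N}$: if $R^{\mathcal{S}}\subseteq\mathbb{N}^d$ is not $\mathrm{FO}[\mathbb{N},+,<]$-definable, then the set $\nu_d(x)^{\mathcal{S}}\subseteq\mathbb{N}$ is not ultimately periodic (hence not $\mathrm{FO}[\mathbb{N},+,<]$-definable).
   Context: $\mathbb{N}$ is the set of non-negative integers. All structures have universe $\mathbb{N}$, and the symbols $+$ and $<$ always have their standard interpretation on $\mathbb{N}$ (addition as a binary function, the usual strict order); thus a $\{+,<,R\}$-structure $\mathcal{S}$ is determined by the interpretation $R^{\mathcal{S}}\subseteq\mathbb{N}^d$ of the $d$-ary relation symbol $R$, which is arbitrary. First-order logic is with equality. Formulas have no parameters. For a formula $\phi(x_0,\dots,x_{d-1})$, the set it defines in $\mathcal{S}$ is $\phi(x_0,\dots,x_{d-1})^{\mathcal{S}}=\{(n_0,\dots,n_{d-1})\in\mathbb{N}^d : \mathcal{S}\models\phi(n_0,\dots,n_{d-1})\}$. A subset of $\mathbb{N}^d$ is $\mathrm{FO}[\mathbb{N},+,<]$-definable if it is defined by some first-order formula over the vocabulary $\{+,<\}$ in $(\mathbb{N},+,<)$. A set $A\subseteq\mathbb{N}$ is ultimately $m$-periodic ($m\ge 1$) if there is $t\in\mathbb{N}$ such that for all $n\ge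 t$, $n\in A$ if and only if $n+m\in A$. It is ultimately periodic if it is ultimately $m$-periodic for some $m\ge 1$. *)

(* Defs.v *)
From mathcomp Require Import all_boot.

Set Implicit Arguments.
Unset Strict Implicit.
Unset Printing Implicit Defensive.

(** First-order logic over vocabularies {+, <} extended with relation symbols.
    Equality, [+] and [<] are built in, so a vocabulary only lists the
    additional relation symbols. *)

Record vocabulary := Vocabulary { relsym : Type; arity : relsym -> nat }.

Definition voc_add_lt : vocabulary :=
  @Vocabulary void (fun r => match r with end).

Definition voc_add_lt_rel (d : nat) : vocabulary :=
  @Vocabulary unit (fun _ => d).

Inductive term (n : nat) : Type :=
| Var of 'I_n
| Add of term n & term n.

(** [formula V n] is the type of formulas whose free variables are among
    x_0, ..., x_{n-1}.  Variables are de Bruijn indices: in the body of a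
    quantifier, index 0 is the bound variable and x_i becomes index i+1. *)
Inductive formula (V : vocabulary) : nat -> Type :=
| Eq n of term n & term n : formula V n
| Lt n of term n & term n : formula V n
| Rel n (r : relsym V) of (arity r).-tuple (term n) : formula V n
| Not n of formula V n : formula V n
| And n of formula V n & formula V n : formula V n
| Or n of formula V n & formula V n : formula V n
| Imp n of formula V n & formula V n : formula V n
| Ex n of formula V n.+1 : formula V n
| All n of formula V n.+1 : formula V n.

(** The universe is [nat] and [+], [<] are standard. *)
Definition structure (V : vocabulary) : Type :=
  forall r : relsym V, (arity r).-tuple nat -> Prop.

Fixpoint eval n (e : n.-tuple nat) (t : term n) : nat :=
  match t with
  | Var i => tnth e i
  | Add t1 t2 => eval e t1 + eval e t2
  end.

Fixpoint sat (V : vocabulary) (S : structure V) n (phi : formula V n) :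
    n.-tuple nat -> Prop :=
  match phi in formula _ n return n.-tuple nat -> Prop with
  | Eq _ t1 t2 => fun e => eval e t1 = eval e t2
  | Lt _ t1 t2 => fun e => eval e t1 < eval e t2
  | Rel _ r ts => fun e => S r (map_tuple (eval e) ts)
  | Not _ p => fun e => ~ sat S p e
  | And _ p q => fun e => sat S p e /\ sat S q e
  | Or _ p q => fun e => sat S p e \/ sat S q e
  | Imp _ p q => fun e => sat S p e -> sat S q e
  | Ex _ p => fun e => exists a : nat, sat S p (cons_tuple a e)
  | All _ p => fun e => forall a : nat, sat S p (cons_tuple a e)
  end.

Definition defined_set (V : vocabulary) (S : structure V) n
    (phi : formula V n) : n.-tuple nat -> Prop :=
  fun v => sat S phi v.

Definition nat_add_lt : structure voc_add_lt :=
  fun r => match r with end.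

Definition FO_add_lt_definable n (X : n.-tuple nat -> Prop) : Prop :=
  exists phi : formula voc_add_lt n,
    forall v : n.-tuple nat, X v <-> defined_set nat_add_lt phi v.

Definition ultimately_m_periodic (m : nat) (A : nat -> Prop) : Prop :=
  exists t : nat, forall n : nat, t <= n -> (A n <-> A (n + m)).

Definition ultimately_periodic (A : nat -> Prop) : Prop :=
  exists m : nat, 1 <= m /\ ultimately_m_periodic m A.

(* Main.v *)
Require Import Defs.
From Stdlib Require Import ZArith Lia FunctionalExtensionality Classical ClassicalEpsilon.
From mathcomp Require Import all_boot.
From mathcomp Require Import zify_ssreflect.

Set Implicit Arguments.
Unset Strict Implicit.
Unset Printing Implicit Defensive.

(** Call a property of structures forced if it holds as soon as one fixed
    parametrised family of definable subsets of the naturals consists, for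
    every value of the parameters, of ultimately periodic sets only.  Forced
    properties are closed under finite conjunction and weakening, and the
    parameters can be eliminated one at a time by always taking the least one
    whose instance fails to be ultimately periodic ([forced_uniform]).
    Quantifier elimination shows that a definable subset of N is ultimately
    periodic ([definable_UP]), so the theorem amounts to: it is forced that [R]
    is definable from [+] and [<].  This is shown by induction on the arity,
    for all definable families of relations at once ([forced_presb]); the
    induction hypothesis says that all coordinate sections of [R] are definable.

    Ultimate periodicity is first turned into growth and sparsity constraints.
    If [H u] is the running maximum of a definable function, the set of values
    of [H] is finite or has bounded gaps, hence [H] grows at most linearly
    ([linear_growth]).  In a definable family of ultimately periodic sets, the
    least periods are bounded: otherwise infinitely many pairs [p], [p + m0] of
    them occur, divisibility by a least period is definable, and
    [p |-> lcm p (p + m0)] grows quadratically ([bounded_period]).  Finally, if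
    [X_s] is a definable family of unbounded subsets of N^n, then for large [s]
    the set [X_s] contains two points at distance at most [s]: its norms have
    a period independent of [s] from a point linear in [s] on, so a box of side
    linear in [s] contains too many points for all of them to be far apart
    ([no_sparse]).

    The occurrences of a pattern of [R] that no translation of size at most [s]
    preserves are more than [s] apart.  Hence there is an [s] such that, for
    every [k], all boxes of side [k] but finitely many have a period of size at
    most [s] ([locally_periodic]; Muchnik isolated this condition).  Take [k]
    large.  The product, over all pairs [p <> q] in [0, s]^n, of the difference
    operators [g |-> (y |-> g (y + p) - g (y + q))] then sends the indicator
    function of [R] to a function of finite support.  The operators can be
    undone one at a time ([integration]): along a line of direction [p - q],
    the difference [h] is, by quantifier elimination, a concatenation of a
    bounded number of periodic stretches, and as [g] is bounded, the sum of [h]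
    over a period of a long stretch is zero, so that [g] can be read off after
    a bounded number of steps, starting from a section of [R]. *)

Local Notation "n %:z" := (Z.of_nat n) (at level 2, left associativity, format "n %:z").

(** * Predicates uniformly definable in all structures *)

(** Assignments are infinite, so that a predicate need not record how many variables
    a formula defining it has, and weakening is invisible. *)
Definition env := nat -> nat.
Definition vec n := 'I_n -> nat.

Definition scons (a : nat) (e : env) : env :=
  fun i => if i is j.+1 then e j else a.

Definition restrict n (e : env) : n.-tuple nat := [tuple e i | i < n].

Fixpoint tren n m (f : 'I_n -> 'I_m) (t : term n) : term m :=
  match t with
  | Var i => Var (f i)
  | Add t1 t2 => Add (tren f t1) (tren f t2)
  end.

(** Lifting of a renaming under a quantifier. *)
Definition up n m (f : 'I_n -> 'I_m) (i : 'I_n.+1) : 'I_m.+1 :=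
  if unlift ord0 i is Some j then lift ord0 (f j) else ord0.

Fixpoint fren V n (phi : formula V n) : forall m, ('I_n -> 'I_m) -> formula V m :=
  match phi in formula _ n return forall m, ('I_n -> 'I_m) -> formula V m with
  | Eq _ t1 t2 => fun m f => Eq V (tren f t1) (tren f t2)
  | Lt _ t1 t2 => fun m f => Lt V (tren f t1) (tren f t2)
  | Rel _ r ts => fun m f => Rel (map_tuple (tren f) ts)
  | Not _ p => fun m f => Not (fren p f)
  | And _ p q => fun m f => And (fren p f) (fren q f)
  | Or _ p q => fun m f => Or (fren p f) (fren q f)
  | Imp _ p q => fun m f => Imp (fren p f) (fren q f)
  | Ex _ p => fun m f => Ex (fren p (up f))
  | All _ p => fun m f => All (fren p (up f))
  end.

Lemma eval_tren n m (f : 'I_n -> 'I_m) (v : m.-tuple nat) t :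
  eval v (tren f t) = eval [tuple tnth v (f i) | i < n] t.
Proof. by elim: t => [i|t1 IH1 t2 IH2] /=; rewrite ?tnth_mktuple ?IH1 ?IH2. Qed.

Lemma cons_up n m (f : 'I_n -> 'I_m) (v : m.-tuple nat) a :
  [tuple tnth (cons_tuple a v) (up f i) | i < n.+1]
  = cons_tuple a [tuple tnth v (f i) | i < n].
Proof.
apply: eq_from_tnth => i; rewrite tnth_mktuple /up.
case: unliftP => [j ->|->]; last by rewrite !tnth0.
by rewrite !tnthS tnth_mktuple.
Qed.

Lemma sat_fren V (S : structure V) n (phi : formula V n) :
  forall m (f : 'I_n -> 'I_m) (v : m.-tuple nat),
  sat S (fren phi f) v <-> sat S phi [tuple tnth v (f i) | i < n].
Proof.
elim: phi => {n}
  [n t1 t2|n t1 t2|n r ts|n p IH|n p IHp q IHq|n p IHp q IHq|n p IHp q IHq|n p IH|n p IH]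
  m f v /=; rewrite ?eval_tren ?IH ?IHp ?IHq //.
- set u := map_tuple _ _; set w := map_tuple _ _; suff -> : u = w by [].
  by apply: eq_from_tnth => i; rewrite !tnth_map eval_tren.
- by split=> -[a]; [move/IH|move=> Ha; exists a; apply/IH; move: Ha];
    rewrite cons_up // => Ha; exists a.
- by split=> H a; [rewrite -cons_up|]; [apply/IH|apply/IH; rewrite cons_up]; apply: H.
Qed.

(** One formula works for all structures: this uniformity is what the theorem asks for. *)
Definition definable V (P : structure V -> env -> Prop) : Prop :=
  exists n (phi : formula V n), forall S e, sat S phi (restrict n e) <-> P S e.

Section Closure.
Variable V : vocabulary.
Implicit Types P Q : structure V -> env -> Prop.

Lemma def_ext P Q : (forall S e, P S e <-> Q S e) -> definable P -> definable Q.
Proof.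
by move=> PQ [n [phi H]]; exists n, phi => S e; rewrite H.
Qed.

(** Renaming combined with weakening: formulas with any sufficiently large number of
    variables are available, so that two of them can be given a common one. *)
Lemma def_extend P (r : nat -> nat) : definable P ->
  exists n0, forall n, n0 <= n -> exists phi : formula V n,
    forall S e, sat S phi (restrict n e) <-> P S (fun i => e (r i)).
Proof.
case=> k [phi H]; exists (\max_(i < k) (r i)).+1 => -[//|n] le_n.
exists (fren phi (fun i : 'I_k => inord (r i) : 'I_n.+1)) => S e.
rewrite sat_fren -H; suff -> : [tuple tnth (restrict n.+1 e) (inord (r i)) | i < k]
  = restrict k (fun i => e (r i)) by [].
apply: eq_from_tnth => i; rewrite !tnth_mktuple inordK //.
by apply: leq_trans le_n; rewrite ltnS; apply: (leq_bigmax i).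
Qed.

Lemma def_ren P (r : nat -> nat) : definable P -> definable (fun S e => P S (fun i => e (r i))).
Proof. by move/(def_extend r) => [n /(_ n (leqnn n)) [phi H]]; exists n, phi. Qed.

Lemma def_common P Q : definable P -> definable Q -> exists n (phi psi : formula V n),
  (forall S e, sat S phi (restrict n e) <-> P S e) /\
  (forall S e, sat S psi (restrict n e) <-> Q S e).
Proof.
move=> /(def_extend id) [n1 H1] /(def_extend id) [n2 H2].
have [phi Hphi] := H1 (maxn n1 n2) (leq_maxl _ _).
have [psi Hpsi] := H2 (maxn n1 n2) (leq_maxr _ _).
by exists (maxn n1 n2), phi, psi.
Qed.

Lemma def_not P : definable P -> definable (fun S e => ~ P S e).
Proof. by case=> n [phi H]; exists n, (Not phi) => S e /=; rewrite H. Qed.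

Lemma def_and P Q : definable P -> definable Q -> definable (fun S e => P S e /\ Q S e).
Proof.
move=> hP hQ; have [n [phi [psi [H1 H2]]]] := def_common hP hQ.
by exists n, (And phi psi) => S e /=; rewrite H1 H2.
Qed.

Lemma def_or P Q : definable P -> definable Q -> definable (fun S e => P S e \/ Q S e).
Proof.
move=> hP hQ; have [n [phi [psi [H1 H2]]]] := def_common hP hQ.
by exists n, (Or phi psi) => S e /=; rewrite H1 H2.
Qed.

Lemma def_imp P Q : definable P -> definable Q -> definable (fun S e => P S e -> Q S e).
Proof.
move=> hP hQ; have [n [phi [psi [H1 H2]]]] := def_common hP hQ.
by exists n, (Imp phi psi) => S e /=; rewrite H1 H2.
Qed.

Lemma def_iff P Q : definable P -> definable Q -> definable (fun S e => P S e <-> Q S e).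
Proof. by move=> hP hQ; apply: def_and; apply: def_imp. Qed.

Lemma restrict_scons n a e : cons_tuple a (restrict n e) = restrict n.+1 (scons a e).
Proof.
apply: eq_from_tnth => i; rewrite tnth_mktuple.
by case: (unliftP ord0 i) => [j ->|->]; rewrite ?tnthS ?tnth0 ?tnth_mktuple.
Qed.

Lemma def_ex (P : structure V -> env -> nat -> Prop) :
  definable (fun S e => P S (fun i => e i.+1) (e 0)) -> definable (fun S e => exists a, P S e a).
Proof.
move/(def_extend id) => [n /(_ n.+1 (leqnSn n)) [phi H]].
exists n, (Ex phi) => S e /=.
by split=> -[a Ha]; exists a; move: Ha; rewrite restrict_scons H.
Qed.

Lemma def_all (P : structure V -> env -> nat -> Prop) :
  definable (fun S e => P S (fun i => e i.+1) (e 0)) -> definable (fun S e => forall a, P S e a).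
Proof.
move/(def_extend id) => [n /(_ n.+1 (leqnSn n)) [phi H]].
exists n, (All phi) => S e /=.
by split=> Ha a; move: (Ha a); rewrite restrict_scons H.
Qed.

(** A function counts as definable when its graph is; there are no terms for constants. *)
Definition definable_fun (t : structure V -> env -> nat) : Prop :=
  definable (fun S e => e 0 = t S (fun i => e i.+1)).

Lemma def_lt_var i j : definable (fun (S : structure V) e => e i < e j).
Proof.
exists (maxn i j).+1, (Lt V (Var (inord i)) (Var (inord j))) => S e /=.
by rewrite !tnth_mktuple !inordK // ltnS ?leq_maxl ?leq_maxr.
Qed.

Lemma def_eq_add i j k : definable (fun (S : structure V) e => e i = e j + e k).
Proof.
exists (i + j + k).+1, (Eq V (Var (inord i)) (Add (Var (inord j)) (Var (inord k)))) => S e /=.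
by rewrite !tnth_mktuple !inordK //; lia.
Qed.

Lemma def_eq_var i j : definable (fun (S : structure V) e => e i = e j).
Proof.
exists (i + j).+1, (Eq V (Var (inord i)) (Var (inord j))) => S e /=.
by rewrite !tnth_mktuple !inordK //; lia.
Qed.

Lemma def_True : definable (fun (S : structure V) e => True).
Proof. by apply: def_ext (def_eq_var 0 0). Qed.

Lemma def_False : definable (fun (S : structure V) e => False).
Proof. by apply: def_ext (def_not def_True) => S e; split=> // /(_ I). Qed.

Lemma def_Prop (A : Prop) : definable (fun (S : structure V) e => A).
Proof.
by case: (classic A) => hA; [apply: def_ext def_True|apply: def_ext def_False] => S e; split.
Qed.

Lemma tdef_var k : definable_fun (fun S e => e k).
Proof. exact: def_eq_var. Qed.

Lemma def_subst (P : structure V -> env -> nat -> Prop) t :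
  definable (fun S e => P S (fun i => e i.+1) (e 0)) -> definable_fun t ->
  definable (fun S e => P S e (t S e)).
Proof.
move=> hP ht; apply: (@def_ext (fun S e => exists a, a = t S e /\ P S e a)).
  by move=> S e; split=> [[a [-> //]]|H]; exists (t S e).
by apply: def_ex; apply: def_and.
Qed.

Lemma def_eq t1 t2 : definable_fun t1 -> definable_fun t2 -> definable (fun S e => t1 S e = t2 S e).
Proof.
move=> h1 h2; apply: (def_subst (P := fun S e a => a = t2 S e) _ h1).
exact: h2.
Qed.

Lemma tdef_ren t (r : nat -> nat) : definable_fun t ->
  definable_fun (fun S e => t S (fun i => e (r i))).
Proof.
by move=> ht; apply: (def_ren (fun i => if i is j.+1 then (r j).+1 else 0)) ht.
Qed.

Lemma tdef_shift t : definable_fun t -> definable_fun (fun S e => t S (fun i => e i.+1)).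
Proof. exact: (tdef_ren (fun i => i.+1)). Qed.

Lemma def_lt t1 t2 : definable_fun t1 -> definable_fun t2 -> definable (fun S e => t1 S e < t2 S e).
Proof.
move=> h1 h2; apply: (def_subst (P := fun S e a => a < t2 S e) _ h1).
apply: (def_subst (P := fun S e a => e 0 < a)); last exact: tdef_shift.
exact: def_lt_var.
Qed.

Lemma def_le t1 t2 :
  definable_fun t1 -> definable_fun t2 -> definable (fun S e => t1 S e <= t2 S e).
Proof.
move=> h1 h2; apply: (@def_ext (fun S e => ~ (t2 S e < t1 S e))).
  by move=> S e; rewrite (leqNgt (t1 S e)); split=> /negP.
exact/def_not/def_lt.
Qed.

Lemma tdef_add t1 t2 :
  definable_fun t1 -> definable_fun t2 -> definable_fun (fun S e => t1 S e + t2 S e).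
Proof.
move=> h1 h2.
apply: (def_subst (P := fun S e a => e 0 = a + t2 S (fun i => e i.+1)));
  last exact: tdef_shift.
apply: (def_subst (P := fun S e a => e 1 = e 0 + a)); last exact: (tdef_ren (fun i => i.+2)).
exact: def_eq_add.
Qed.

(** Zero is the only [x] with [x = x + x]. *)
Lemma tdef_0 : definable_fun (fun S e => 0).
Proof.
apply: (@def_ext (fun S e => e 0 = e 0 + e 0)); last exact: def_eq_add.
by move=> S e; lia.
Qed.

Lemma tdef_S t : definable_fun t -> definable_fun (fun S e => (t S e).+1).
Proof.
move=> ht; apply: (@def_ext (fun S e => t S (fun i => e i.+1) < e 0 /\
   forall a, t S (fun i => e i.+1) < a -> e 0 <= a)).
  move=> S e; set s := t _ _; split=> [[h1 /(_ _ (ltnSn s))]|->]; first by lia.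
  by split.
apply: def_and; first by apply: def_lt; [exact: tdef_shift | exact: tdef_var].
apply: def_all; apply: def_imp; first apply: def_lt.
- exact: (tdef_ren (fun i => i.+2)).
- exact: tdef_var.
- by apply: def_le; exact: tdef_var.
Qed.

Lemma tdef_const c : definable_fun (fun S e => c).
Proof. by elim: c => [|c IH]; [exact: tdef_0|exact: tdef_S]. Qed.

Lemma tdef_mulc c t : definable_fun t -> definable_fun (fun S e => c * t S e).
Proof.
move=> ht; elim: c => [|c IH]; first exact: tdef_0.
apply: def_ext (tdef_add ht IH) => S e; by rewrite mulSn.
Qed.

Lemma def_allI n (P : 'I_n -> structure V -> env -> Prop) :
  (forall i, definable (P i)) -> definable (fun S e => forall i, P i S e).
Proof.
elim: n P => [|n IH] P hP.
  by apply: def_ext def_True => S e; split=> // _ [].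
apply: (@def_ext (fun S e => P ord0 S e /\ forall i : 'I_n, P (lift ord0 i) S e)).
  move=> S e; split=> [[h0 h1] i|h]; last by split.
  by case: (unliftP ord0 i) => [j ->|->].
by apply: def_and => //; apply: IH => i.
Qed.

Lemma def_exI n (P : 'I_n -> structure V -> env -> Prop) :
  (forall i, definable (P i)) -> definable (fun S e => exists i, P i S e).
Proof.
move=> hP; apply: (@def_ext (fun S e => ~ forall i, ~ P i S e)).
  by move=> S e; split=> [/not_all_ex_not [i /NNPP]|[i Hi] H]; [exists i|exact: (H i)].
by apply: def_not; apply: def_allI => i; apply: def_not.
Qed.

Lemma def_allF (T : finType) (P : T -> structure V -> env -> Prop) :
  (forall i, definable (P i)) -> definable (fun S e => forall i, P i S e).
Proof.
move=> hP; apply: def_ext (def_allI (fun i => hP (enum_val i : T))) => S e.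
by split=> h i //; rewrite -(enum_rankK i).
Qed.

Definition vcons n a (x : vec n) : vec n.+1 :=
  fun i => if unlift ord0 i is Some j then x j else a.

Lemma vconsE n (x : vec n.+1) : x = vcons (x ord0) (fun i => x (lift ord0 i)).
Proof.
by apply: functional_extensionality => i; rewrite /vcons; case: unliftP => [j ->|->].
Qed.

Lemma def_exv n (P : structure V -> env -> vec n -> Prop) :
  definable (fun S e => P S (fun i => e (n + i)) (fun i => e i)) ->
  definable (fun S e => exists x, P S e x).
Proof.
elim: n P => [|n IH] P hP.
  apply: def_ext hP => S e; split=> [h|[x h]]; first by exists (fun i : 'I_0 => e i).
  by have -> : (fun i : 'I_0 => e i) = x by apply: functional_extensionality => -[].
apply: (@def_ext (fun S e => exists x a, P S e (vcons a x))).
  move=> S e; split=> [[x [a h]]|[x h]]; first by exists (vcons a x).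
  by exists (fun i => x (lift ord0 i)), (x ord0); rewrite -vconsE.
apply: (IH (fun S e x => exists a, P S e (vcons a x))); apply: def_ex.
apply: def_ext (def_ren (fun i => if i <= n then (if i is j.+1 then i else 0) else i) hP) => S e.
set x1 := (fun i : 'I_n.+1 => _); set x2 := vcons _ _.
have -> : x1 = x2.
  apply: functional_extensionality => i; rewrite /x1 /x2 /vcons -ltnS ltn_ord.
  by case: unliftP => [j ->|->].
set e1 := (fun i => _); set e2 := (fun i => _).
suff -> : e1 = e2 by [].
apply: functional_extensionality => i; rewrite /e1 /e2 ifF //.
by apply/negbTE; rewrite -ltnNge; lia.
Qed.

Lemma def_allv n (P : structure V -> env -> vec n -> Prop) :
  definable (fun S e => P S (fun i => e (n + i)) (fun i => e i)) ->
  definable (fun S e => forall x, P S e x).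
Proof.
move=> hP; apply: (@def_ext (fun S e => ~ exists x, ~ P S e x)).
  move=> S e; split=> [h x|h [x]]; last by move/(_ (h x)).
  by apply: NNPP => hx; apply: h; exists x.
by apply: def_not; apply: (def_exv (P := fun S e x => ~ P S e x)); apply: def_not.
Qed.

(** Families of subsets of N^n: the vector comes first in the assignment, the parameters follow. *)
Definition definable_vec n (F : structure V -> env -> vec n -> Prop) : Prop :=
  definable (fun S e => F S (fun i => e (n + i)) (fun i => e i)).

Definition vapp n (x : vec n) (e : env) : env :=
  fun i => if insub i is Some j then x j else e (i - n).

Lemma vapp_l n (x : vec n) e : (fun i : 'I_n => vapp x e i) = x.
Proof. by apply: functional_extensionality => i; rewrite /vapp valK. Qed.

Lemma vapp_r n (x : vec n) e : (fun i => vapp x e (n + i)) = e.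
Proof.
by apply: functional_extensionality => i; rewrite /vapp insubN ?addKn // -leqNgt leq_addr.
Qed.

Lemma fdef_ren n (F : structure V -> env -> vec n -> Prop) (k : nat -> nat) (r : 'I_n -> nat) :
  definable_vec F -> definable (fun S e => F S (fun i => e (k i)) (fun i => e (r i))).
Proof.
move=> hF; have := def_ren (vapp r k) hF; apply: def_ext => S e.
have -> : (fun i : 'I_n => e (vapp r k i)) = (fun i => e (r i)).
  by apply: functional_extensionality => i; rewrite -[in RHS](vapp_l r k).
suff -> : (fun i => e (vapp r k (n + i))) = (fun i => e (k i)) by [].
by apply: functional_extensionality => i; rewrite -[in RHS](vapp_r r k).
Qed.

Lemma fdef_subst n (F : structure V -> env -> vec n -> Prop) (k : nat -> nat)
    (t : 'I_n -> structure V -> env -> nat) :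
  definable_vec F -> (forall i, definable_fun (t i)) ->
  definable (fun S e => F S (fun i => e (k i)) (fun i => t i S e)).
Proof.
move=> hF ht; apply: (@def_ext (fun S e => exists x : vec n,
  (forall i, x i = t i S e) /\ F S (fun i => e (k i)) x)).
  move=> S e; split=> [[x [hx h]]|h]; last by exists (fun i => t i S e).
  suff -> : (fun i => t i S e) = x by [].
  by apply: functional_extensionality => i; rewrite hx.
apply: def_exv; apply: def_and.
  apply: def_allI => i; apply: def_eq; first exact: tdef_var.
  exact: (tdef_ren (fun i => n + i)).
exact: (fdef_ren (fun i => n + k i)).
Qed.

End Closure.

Definition definable1 V (A : structure V -> env -> nat -> Prop) : Prop :=
  definable (fun S e => A S (fun i => e i.+1) (e 0)).


Definition definable2 V (A : structure V -> env -> nat -> nat -> Prop) : Prop :=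
  definable (fun S e => A S (fun i => e i.+2) (e 0) (e 1)).

Section Subst.
Variable V : vocabulary.

Lemma fdef1_subst (A : structure V -> env -> nat -> Prop) (k : nat -> nat) t :
  definable1 A -> definable_fun t -> definable (fun S e => A S (fun i => e (k i)) (t S e)).
Proof.
move=> hA ht; apply: (def_subst (P := fun S e a => A S (fun i => e (k i)) a) _ ht).
exact: (def_ren (scons 0 (fun i => (k i).+1)) hA).
Qed.

Lemma fdef2_subst (A : structure V -> env -> nat -> nat -> Prop) (k : nat -> nat) t u :
  definable2 A -> definable_fun t -> definable_fun u -> definable (fun S e => A S (fun i => e (k i)) (t S e) (u S e)).
Proof.
move=> hA ht hu.
apply: (def_subst (P := fun S e a => A S (fun i => e (k i)) a (u S e)) _ ht).
apply: (def_subst (P := fun S e a => A S (fun i => e (k i).+1) (e 0) a)).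
  exact: (def_ren (scons 1 (scons 0 (fun i => (k i).+2))) hA).
exact: tdef_shift.
Qed.

End Subst.

(** Splits a definability goal along its syntax; what remains are the occurrences of abstract
    families, to be closed by the substitution lemmas. *)
Ltac sdef_step :=
  lazymatch goal with
  | |- definable (fun _ _ => _ <-> _) => apply def_iff
  | |- definable (fun _ _ => ~ _) => apply def_not
  | |- definable (fun _ _ => _ /\ _) => apply def_and
  | |- definable (fun _ _ => _ \/ _) => apply def_or
  | |- definable (fun _ _ => exists x : nat, _) => apply def_ex
  | |- definable (fun _ _ => exists x : vec _, _) => apply def_exv
  | |- definable (fun _ _ => exists x : 'I_ _, _) => apply def_exI; intro
  | |- definable (fun _ _ => forall x : nat, _) => apply def_all
  | |- definable (fun _ _ => forall x : vec _, _) => apply def_allv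
  | |- definable (fun _ _ => forall x : 'I_ _, _) => apply def_allI; intro
  | |- definable (fun _ _ => _ -> _) => apply def_imp
  | |- definable (fun _ _ => is_true (_ < _)) => apply def_lt
  | |- definable (fun _ _ => is_true (_ <= _)) => apply def_le
  | |- definable (fun _ _ => _ = _ :> nat) => apply def_eq
  | |- definable (fun _ _ => ?A) => apply def_Prop
  | |- definable_fun (fun _ _ => _ + _) => apply tdef_add
  | |- definable_fun (fun _ _ => _.+1) => apply tdef_S
  | |- definable_fun (fun _ f => f _) => apply tdef_var
  | |- definable_fun (fun _ _ => _ * _) => apply tdef_mulc
  | |- definable_fun (fun _ _ => _) => apply tdef_const
  end.

Ltac sdef := repeat (cbv beta; first [ eassumption | sdef_step ]).

(** * Properties forced by ultimate periodicity *)

Section Forced.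
Variable V : vocabulary.

Lemma fdef_UP (A : structure V -> env -> nat -> Prop) (k : nat -> nat) :
  definable1 A -> definable (fun S e => ultimately_periodic (A S (fun i => e (k i)))).
Proof.
move=> hA; rewrite /ultimately_periodic /ultimately_m_periodic.
sdef.
- exact: (fdef1_subst (fun i => (k i).+3)) (tdef_var _ _).
- by apply: (fdef1_subst (fun i => (k i).+3)) => //; sdef.
Qed.

Lemma ex_least (Q : nat -> Prop) : (exists n, Q n) -> exists n, Q n /\ forall m, m < n -> ~ Q m.
Proof.
case=> n; elim/ltn_ind: n => n IH Qn.
case: (classic (exists m, m < n /\ Q m)) => [[m [lt_mn Qm]]|H]; first exact: (IH m).
by exists n; split=> // m lt_mn Qm; apply: H; exists m.
Qed.

Lemma UP_ext (A B : nat -> Prop) : (forall x, A x <-> B x) -> ultimately_periodic A ->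
  ultimately_periodic B.
Proof.
by move=> AB [m [m1 [t H]]]; exists m; split=> //; exists t => n /H; rewrite !AB.
Qed.

Definition forced (Q : structure V -> Prop) : Prop :=
  exists P, definable1 P /\ forall S, (forall e, ultimately_periodic (P S e)) -> Q S.

Lemma forced_UP P : definable1 P -> forced (fun S => forall e, ultimately_periodic (P S e)).
Proof. by move=> hP; exists P. Qed.

Lemma forced_weaken (Q R : structure V -> Prop) :
  (forall S, Q S -> R S) -> forced Q -> forced R.
Proof. by move=> QR [P [hP H]]; exists P; split=> // S /H /QR. Qed.

Lemma forced_True (Q : structure V -> Prop) : (forall S, Q S) -> forced Q.
Proof.
by move=> HQ; exists (fun _ _ _ => True); split=> //; apply: def_True.
Qed.

(** An additional parameter tells which of the two families is meant. *)
Lemma forced_and (Q R : structure V -> Prop) :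
  forced Q -> forced R -> forced (fun S => Q S /\ R S).
Proof.
move=> [P [hP HP]] [P' [hP' HP']].
exists (fun S e x => (e 0 = 0 -> P S (fun i => e i.+1) x) /\
                     (e 0 <> 0 -> P' S (fun i => e i.+1) x)); split.
  rewrite /definable1; sdef.
  - exact: (fdef1_subst (fun i => i.+2)) (tdef_var _ _).
  - exact: (fdef1_subst (fun i => i.+2)) (tdef_var _ _).
move=> S H; split; [apply: HP|apply: HP'] => e.
- by apply: UP_ext (H (scons 0 e)) => x /=; split=> [[h _]|h]; [exact: h|split].
- by apply: UP_ext (H (scons 1 e)) => x /=; split=> [[_ h]|h]; [exact: h|split].
Qed.

Lemma forced_allI n (Q : 'I_n -> structure V -> Prop) :
  (forall i, forced (Q i)) -> forced (fun S => forall i, Q i S).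
Proof.
elim: n Q => [|n IH] Q hQ; first by apply: forced_True => S [].
apply: forced_weaken (forced_and (hQ ord0) (IH _ (fun i => hQ (lift ord0 i)))).
by move=> S [h0 h1] i; case: (unliftP ord0 i) => [j ->|->].
Qed.

(** Eliminates the parameter stored first: the least value with a bad instance selects that
    instance, and without bad instances the set is empty. *)
Definition least_bad (P : structure V -> env -> nat -> Prop) S e x : Prop :=
  exists a, ~ ultimately_periodic (P S (scons a e)) /\
    (forall b, b < a -> ultimately_periodic (P S (scons b e))) /\
    P S (scons a e) x.

Lemma fdef_scons (P : structure V -> env -> nat -> Prop) : definable1 P ->
  definable2 (fun S e a x => P S (scons a e) x).
Proof.
move=> hP; apply: def_ext (fdef1_subst (fun i => if i is j.+1 then j.+2 else 0) hP (tdef_var _ 1)).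
move=> S e /=; suff -> : (fun i => e (if i is j.+1 then j.+2 else 0)) = scons (e 0) (fun i => e i.+2) by [].
by apply: functional_extensionality => -[].
Qed.

Lemma fdef_least_bad P : definable1 P -> definable1 (least_bad P).
Proof.
move=> hP; have hP2 := fdef_scons hP.
have hU (k : nat -> nat) : definable (fun S e => ultimately_periodic (P S (scons (e 0) (fun i => e (k i))))).
  apply: def_ext (fdef_UP (fun i => if i is j.+1 then k j else 0) hP).
  move=> S e /=; suff -> : (fun i => e (if i is j.+1 then k j else 0)) =
     scons (e 0) (fun i => e (k i)) by [].
  by apply: functional_extensionality => -[].
rewrite /definable1 /least_bad; sdef; exact: hU.
Qed.

Lemma least_badP P S e :
  ultimately_periodic (least_bad P S e) -> forall a, ultimately_periodic (P S (scons a e)).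
Proof.
move=> H a; apply: NNPP => Ha.
have [b [hb hmin]] := ex_least (ex_intro (fun a => ~ ultimately_periodic (P S (scons a e))) a Ha).
apply: (hb); apply: UP_ext H => x; split=> [[c [h1 [h2 h3]]]|h].
  suff -> : b = c by [].
  case: (ltngtP b c) => // hbc; first by case: hb; apply: h2.
  by case: (hmin c hbc).
by exists b; split=> //; split=> // c /hmin /NNPP.
Qed.

(** A formula has finitely many parameters, so iterating [least_bad] removes all of them; the
    assignment that is left over can be taken constantly zero. *)
Lemma forced_uniform Q : forced Q -> exists nu : formula V 1,
  forall S, ultimately_periodic (fun n => defined_set S nu [tuple n]) -> Q S.
Proof.
case=> P [hP HQ].
pose L k := iter k least_bad P.
have hL k : definable1 (L k) by elim: k => //= k IH; apply: fdef_least_bad.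
have [n0 [phi0 Hphi0]] := hP.
pose z : env := fun => 0.
have [m [phi Hphi]] : definable (fun S e => L n0 S z (e 0)).
  apply: (def_subst (P := fun S e a => L n0 S (fun => a) (e 0)) _ (tdef_const _ 0)).
  exact: (def_ren (fun i => if i is j.+1 then 0 else 1) (hL n0)).
exists (fren phi (fun _ => ord0)) => S HS; apply: HQ => e.
have H0 : ultimately_periodic (L n0 S z).
  apply: UP_ext HS => x; rewrite /defined_set sat_fren -(Hphi S (fun => x)).
  set u := [tuple _ | _ < _]; suff -> : u = restrict m (fun => x) by [].
  by apply: eq_from_tnth => i; rewrite !tnth_mktuple.
have HL k f : ultimately_periodic (L k S f) -> forall e, (forall i, e (k + i) = f i) -> ultimately_periodic (P S e).
  elim: k f => [|k IH] f Hf e' He'.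
    by have -> : e' = f by apply: functional_extensionality => i; rewrite -He'.
  apply: (IH (scons (e' k) f)); first exact: least_badP.
  by case=> [|i]; rewrite ?addn0 //= -He' addSnnS.
pose e' i := if i < n0 then e i else 0.
have He' : ultimately_periodic (P S e').
  by apply: HL H0 _ _ => i; rewrite /e' ltnNge leq_addr.
apply: UP_ext He' => x; rewrite -(Hphi0 S (scons x e')) -(Hphi0 S (scons x e)).
suff -> : restrict n0 (scons x e') = restrict n0 (scons x e) by [].
apply: eq_from_tnth => -[[|i] lti]; rewrite !tnth_mktuple //= /e' ifT //.
exact: ltnW.
Qed.
End Forced.

(** * Linear growth and bounded periods *)

Section Tame.
Variable V : vocabulary.
Implicit Types S : structure V.

Section Envelope.
Variable G : nat -> nat -> Prop.
Definition below_max u y := exists u', u' <= u /\ exists y', y <= y' /\ G u' y'.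
(** The values of the function u |-> max {y | below_max u y}. *)
Definition running_max y := exists u, below_max u y /\ ~ below_max u y.+1.

(** If [m] is a period of [running_max] from [t] on and [z > t + m] is the maximum up to [u + 1],
    then [z - m] is also a value of the running maximum, necessarily one attained before [u + 1].
    So above [t + m] the maximum increases by at most [m] at each step. *)
Lemma linear_growth_of_UP :
  (forall u, exists b, forall y, G u y -> y <= b) -> ultimately_periodic running_max ->
  exists C, forall u y, G u y -> y <= C * u.+1.
Proof.
move=> Gb [m [m1 [t Ht]]].
have Ub u : exists b, forall y, below_max u y -> y <= b.
  elim: u => [|u [b Hb]].
    have [b Hb] := Gb 0; exists b => y [u' [u0 [y' [le_y g]]]].
    have E : u' = 0 by lia.
    by rewrite E in g; have := Hb _ g; lia.
  have [b' Hb'] := Gb u.+1; exists (b + b') => y [u' [u0 [y' [le_y g]]]].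
  case: (leqP u' u) => hu; last first.
    have E : u' = u.+1 by lia.
    by rewrite E in g; have := Hb' _ g; lia.
  suff : y <= b by lia.
  by apply: Hb; exists u'; split=> //; exists y'.
have [b0 Hb0] := Ub 0.
pose C := b0 + t + m.
suff H u y : below_max u y -> y <= C * u.+1.
  by exists C => u y g; apply: H; exists u; split=> //; exists y.
elim: u y => [|u IH] y hy; first by have := Hb0 y hy; lia.
have [b Hb] := Ub u.+1.
have [z [hz hmin]] : exists z, ~ below_max u.+1 z /\ forall m, m < z -> ~ ~ below_max u.+1 m.
  by apply: ex_least; exists b.+1 => /Hb; lia.
have down v a c : a <= c -> below_max v c -> below_max v a.
  by move=> le_ac [v' [hv [c' [hc g]]]]; exists v'; split=> //; exists c'; split=> //; lia.
have mono v v' a : v <= v' -> below_max v a -> below_max v' a.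
  by move=> le_v [w [hw [c g]]]; exists w; split; [lia|exists c].
have lt_yz : y < z by rewrite ltnNge; apply/negP => /down /(_ hy).
case: z => // z in hz hmin lt_yz *.
have hz' : below_max u.+1 z by apply: NNPP; apply: hmin.
case: (leqP z (t + m)) => hzt; first by rewrite /C; nia.
have : running_max (z - m).
  apply/(Ht _); first by lia.
  by rewrite subnK; [exists u.+1|lia].
case=> v [hv1 hv2].
have le_vu : v <= u.
  rewrite leqNgt; apply/negP => lt_uv; apply: hv2; apply: (down _ _ z); first by lia.
  exact: mono hz'.
have := IH _ (mono _ _ _ le_vu hv1); rewrite /C => ?; nia.
Qed.
End Envelope.

Lemma linear_growth (G : structure V -> env -> nat -> nat -> Prop) : definable2 G ->
  forced (fun S => forall e, (forall u, exists b, forall y, G S e u y -> y <= b) ->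
    exists C, forall u y, G S e u y -> y <= C * u.+1).
Proof.
move=> hG; apply: (@forced_weaken _ (fun S => forall e, ultimately_periodic (running_max (G S e)))).
  by move=> S H e Gb; apply: linear_growth_of_UP.
apply: forced_UP; rewrite /definable1 /running_max /below_max; sdef.
- exact: (fdef2_subst (fun i => i.+4) hG (tdef_var _ _) (tdef_var _ _)).
- exact: (fdef2_subst (fun i => i.+4) hG (tdef_var _ _) (tdef_var _ _)).
Qed.


Lemma per_add A a b :
  ultimately_m_periodic a A -> ultimately_m_periodic b A -> ultimately_m_periodic (a + b) A.
Proof.
move=> [t Ht] [u Hu]; exists (t + u) => n hn.
rewrite addnA; apply: (iff_trans (Ht n _)); first by lia.
by apply: Hu; lia.
Qed.

Lemma per_mul A a k : ultimately_m_periodic a A -> ultimately_m_periodic (k * a) A.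
Proof.
by move=> ha; elim: k => [|k IH]; [exists 0 => n _; rewrite addn0|rewrite mulSn; apply: per_add].
Qed.

Lemma per_sub A a b :
  ultimately_m_periodic (a + b) A -> ultimately_m_periodic a A -> ultimately_m_periodic b A.
Proof.
move=> [t Ht] [u Hu]; exists (t + u) => n hn.
apply: (iff_trans (Ht n _)); first by lia.
by apply: iff_sym; rewrite [a + b]addnC addnA; apply: Hu; lia.
Qed.

Definition least_per p (A : nat -> Prop) : Prop :=
  0 < p /\ ultimately_m_periodic p A /\ forall q, q < p -> 0 < q -> ~ ultimately_m_periodic q A.

(** Periods are closed under sums and differences, so they are the multiples of the least one. *)
Lemma least_perP p A x : least_per p A -> ultimately_m_periodic x A <-> p %| x.
Proof.
move=> [p0 [hp hmin]]; split=> [hx|/dvdnP [k ->]]; last exact: per_mul.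
apply/negPn/negP => hnd; apply: (hmin (x %% p)); first by rewrite ltn_mod.
  by rewrite lt0n.
apply: (@per_sub _ (x %/ p * p)); last exact: per_mul.
by rewrite -divn_eq.
Qed.

Lemma UP_least_per A : ultimately_periodic A -> exists p, least_per p A.
Proof.
case=> m [m1 hm].
have [p [[p0 hp] hmin]] := ex_least (ex_intro (fun m => 0 < m /\ ultimately_m_periodic m A) m (conj m1 hm)).
by exists p; split=> //; split=> // q /hmin hq q0 hpq; apply: hq.
Qed.

(** When [p] is the least period of some member of the family, this says that [p] divides [z];
    hence [least_common] below is the graph of p |-> lcm p (p + m0). *)
Definition common_period (A : env -> nat -> Prop) p z : Prop :=
  0 < z /\ exists e, least_per p (A e) /\ ultimately_m_periodic z (A e).

Definition least_common (A : env -> nat -> Prop) m0 p z : Prop :=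
  common_period A p z /\ common_period A (p + m0) z /\
  forall z', z' < z -> ~ (common_period A p z' /\ common_period A (p + m0) z').

(** If the set of least periods is unbounded, being ultimately [m0]-periodic it contains both
    [p] and [p + m0] for arbitrarily large [p].  As the gcd of the two divides [m0], their lcm is at
    least [p * (p + m0) / m0], which contradicts linear growth. *)
Lemma bounded_period_of_growth (A : env -> nat -> Prop) :
  (forall e, ultimately_periodic (A e)) ->
  ultimately_periodic (fun p => exists e, least_per p (A e)) ->
  (forall m0, (forall u, exists b, forall y, least_common A m0 u y -> y <= b) ->
     exists C, forall u y, least_common A m0 u y -> y <= C * u.+1) ->
  exists M, 0 < M /\ forall e, ultimately_m_periodic M (A e).
Proof.
move=> hA hQ hG; pose Q p := exists e, least_per p (A e).
have comP p z : Q p -> common_period A p z <-> 0 < z /\ p %| z.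
  move=> [e he]; split=> [[z0 [e' [he' hz]]]|[z0 hz]].
    by split=> //; apply/(least_perP _ he').
  by split=> //; exists e; split=> //; apply/(least_perP _ he).
have comQ p z : common_period A p z -> Q p by case=> _ [e [he _]]; exists e.
case: (classic (exists B, forall p, Q p -> p <= B)) => [[B HB]|Hunb].
  (* All least periods divide the factorial of their bound. *)
  exists B`!; split; first exact: fact_gt0.
  move=> e; have [p hp] := UP_least_per (hA e).
  apply/(least_perP _ hp); apply: dvdn_fact.
  by case: (hp) => p0 _; rewrite p0 /=; apply: HB; exists e.
case: hQ => m0 [m1 [t Ht]].
have [C HC] : exists C, forall u y, least_common A m0 u y -> y <= C * u.+1.
  apply: hG => u.
  case: (classic (exists y, least_common A m0 u y)) => [[y hy]|H]; last first.
    by exists 0 => y hy; case: H; exists y.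
  exists y => z hz; rewrite leqNgt; apply/negP => lt_yz.
  by case: hz => _ [_ /(_ _ lt_yz)]; case: hy => h1 [h2 _]; apply.
have [q [hq lt_q]] : exists q, Q q /\ t <= q.
  apply: NNPP => H; apply: Hunb; exists t => p hp; rewrite leqNgt; apply/negP => lt_tp.
  by apply: H; exists p; split=> //; apply: ltnW.
have hqi i : Q (q + i * m0).
  elim: i => [|i IH]; first by rewrite addn0.
  by rewrite mulSn [m0 + _]addnC addnA; apply/(Ht (q + i * m0)) => //; lia.
(* [p] is large enough for [C * (p + 1) * m0 < p * (p + m0)]. *)
pose i := 2 * C * m0 + 1; pose p := q + i * m0.
have p_big : 2 * C * m0 < p by rewrite /p /i; nia.
have hp : Q p := hqi i.
have hp' : Q (p + m0).
  by have := hqi i.+1; rewrite mulSn [m0 + _]addnC addnA.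
have p0 : 0 < p by lia.
have [z [hz hzmin]] : exists z, (common_period A p z /\ common_period A (p + m0) z) /\
   forall z', z' < z -> ~ (common_period A p z' /\ common_period A (p + m0) z').
  apply: ex_least; exists (p * (p + m0)); split; apply/comP => //; split; try nia.
    exact: dvdn_mulr.
  exact: dvdn_mull.
have := HC p z; case: hz => hz1 hz2 /(_ (conj hz1 (conj hz2 hzmin))).
move/(comP _ _ hp): hz1 => [z0 d1]; move/(comP _ _ hp'): hz2 => [_ d2].
have le_lcm : lcmn p (p + m0) <= z by rewrite dvdn_leq // dvdn_lcm d1 d2.
have := muln_lcm_gcd p (p + m0); rewrite gcdnDl.
have : gcdn p m0 <= m0 by rewrite dvdn_leq ?dvdn_gcdr.
set l := lcmn _ _ in le_lcm *; set g := gcdn _ _ => le_g E le_z.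
have h1 : l * g <= z * m0 by apply: leq_mul.
have h2 : z * m0 <= C * p.+1 * m0 by rewrite leq_mul2r le_z orbT.
have h3 : C * p.+1 * m0 <= p * (2 * C * m0) by nia.
have h4 : p * (p + m0) <= p * (2 * C * m0) by rewrite -E; lia.
by rewrite leq_pmul2l // in h4; lia.
Qed.

(** Quantification over a whole assignment is first-order, since a formula only sees a finite
    part of it. *)
Lemma def_exenv k (P : structure V -> env -> Prop) : definable P ->
  definable (fun S e => exists c : env, P S (vapp (fun i : 'I_k => e i) c)).
Proof.
move/(def_extend id) => [n0 /(_ _ (leqnn n0)) [phi Hphi]].
apply: (@def_ext _ (fun S e => exists c : vec n0,
   P S (vapp (fun i : 'I_k => e i) (vapp c (fun j => e (k + j)))))).
  move=> S e; split=> [[c h]|[c h]]; first by exists (vapp c (fun j => e (k + j))).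
  exists (fun j : 'I_n0 => c j); move: h.
  rewrite -[P _ (vapp _ c)]Hphi -[P _ (vapp _ _)]Hphi.
  set u := restrict _ _; set v := restrict _ _; suff -> : u = v by [].
  apply: eq_from_tnth => i; rewrite !tnth_mktuple /vapp.
  case: insubP => // /negbTE hik; case: insubP => [j _ <- //|].
  by have := ltn_ord i; lia.
apply: def_exv.
apply: def_ext (def_ren (fun i => if i < k then n0 + i else
   if i - k < n0 then i - k else i) (ex_intro _ n0 (ex_intro _ phi Hphi))) => S e.
set u := (fun i => _); set v := vapp _ _; suff -> : u = v by [].
apply: functional_extensionality => i; rewrite /u /v /vapp.
case: insubP => [j lt_ik E|/negbTE hik]; first by rewrite lt_ik E.
rewrite hik; case: insubP => [j -> -> //|/negbTE h]; rewrite h; congr e. move: hik h. lia.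
Qed.

Lemma fdef1_exenv (A : structure V -> env -> nat -> Prop) : definable1 A ->
  definable1 (fun S e x => exists c, A S c x).
Proof.
move/(def_exenv 1); apply: def_ext => S e.
suff H c : vapp (fun i : 'I_1 => e i) c = scons (e 0) c.
  by split=> -[c h]; exists c; move: h; rewrite H.
apply: functional_extensionality => -[|i]; rewrite /vapp; case: insubP => [j hj Ej|hj] //.
  by rewrite Ej.
by rewrite subSS subn0.
Qed.

Lemma fdef2_exenv (A : structure V -> env -> nat -> nat -> Prop) : definable2 A ->
  definable2 (fun S e x y => exists c, A S c x y).
Proof.
move/(def_exenv 2); apply: def_ext => S e.
suff H c : vapp (fun i : 'I_2 => e i) c = scons (e 0) (scons (e 1) c).
  by split=> -[c h]; exists c; move: h; rewrite H.
apply: functional_extensionality => -[|[|i]]; rewrite /vapp;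
  case: insubP => [j hj Ej|hj] //; rewrite ?Ej //.
by rewrite !subSS subn0.
Qed.

Lemma fdef_per (A : structure V -> env -> nat -> Prop) (k : nat -> nat) t :
  definable1 A -> definable_fun t -> definable (fun S e => ultimately_m_periodic (t S e) (A S (fun i => e (k i)))).
Proof.
move=> hA ht.
apply: (def_subst (P := fun S e a => ultimately_m_periodic a (A S (fun i => e (k i)))) _ ht).
rewrite /ultimately_m_periodic; sdef.
- exact: (fdef1_subst (fun i => (k i).+3) hA (tdef_var _ _)).
- by apply: (fdef1_subst (fun i => (k i).+3) hA); sdef.
Qed.

Lemma fdef_least_per (A : structure V -> env -> nat -> Prop) (k : nat -> nat) t :
  definable1 A -> definable_fun t -> definable (fun S e => least_per (t S e) (A S (fun i => e (k i)))).
Proof.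
move=> hA ht.
apply: (def_subst (P := fun S e a => least_per a (A S (fun i => e (k i)))) _ ht).
rewrite /least_per; sdef.
- exact: (fdef_per (fun i => (k i).+1) hA (tdef_var _ _)).
- exact: (fdef_per (fun i => (k i).+2) hA (tdef_var _ _)).
Qed.

Lemma bounded_period (A : structure V -> env -> nat -> Prop) : definable1 A ->
  forced (fun S => exists M, 0 < M /\ forall e, ultimately_m_periodic M (A S e)).
Proof.
move=> hA.
have hQ : definable1 (fun S _ p => exists e, least_per p (A S e)).
  apply: (fdef1_exenv (A := fun S e p => least_per p (A S e))).
  exact: (fdef_least_per (fun i => i.+1) hA (tdef_var _ _)).
have hC : definable2 (fun S (_ : env) p z => common_period (A S) p z).
  rewrite /definable2 /common_period; sdef.
  apply: (fdef2_exenv (A := fun S e p z => least_per p (A S e) /\ ultimately_m_periodic z (A S e))).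
  apply: def_and.
    exact: (fdef_least_per (fun i => i.+2) hA (tdef_var _ _)).
  exact: (fdef_per (fun i => i.+2) hA (tdef_var _ _)).
have hG : definable2 (fun S e p z => least_common (A S) (e 0) p z).
  rewrite /definable2 /least_common; sdef;
  by apply: (fdef2_subst (fun i => i.+2) hC); sdef.
apply: forced_weaken (forced_and (forced_UP hA) (forced_and (forced_UP hQ) (linear_growth hG))).
move=> S [h1 [h2 h3]]; apply: bounded_period_of_growth => //.
  exact: (h2 (fun => 0)).
by move=> m0; apply: (h3 (fun => m0)).
Qed.
End Tame.

(** * Sparse families and local periodicity *)

Definition vnorm n (x : vec n) : nat := \max_(i < n) x i.

Lemma vnorm_leP n (x : vec n) u : (forall i, x i <= u) <-> vnorm x <= u.
Proof. by split=> [h|/bigmax_leqP h i]; [apply/bigmax_leqP => i _|apply: h]. Qed.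

Lemma vnorm_eqP n (x : vec n) u : vnorm x = u <->
  (forall i, x i <= u) /\ forall w, (forall i, x i <= w) -> u <= w.
Proof.
split=> [<-|[/vnorm_leP h1 h2]].
  by split=> [|w /vnorm_leP //]; apply/vnorm_leP.
by apply/eqP; rewrite eqn_leq h1 h2 //; apply/vnorm_leP.
Qed.

Definition bounded n (X : vec n -> Prop) : Prop := exists b, forall x, X x -> vnorm x <= b.

Lemma unboundedP n (X : vec n -> Prop) : ~ bounded X -> forall b, exists x, X x /\ b < vnorm x.
Proof.
move=> H b; apply: NNPP => Hb; apply: H; exists b => x Xx; rewrite leqNgt; apply/negP => lt_b.
by apply: Hb; exists x.
Qed.

Definition sparse n s (X : vec n -> Prop) : Prop :=
  forall x y, X x -> X y -> (forall i, x i <= y i + s /\ y i <= x i + s) -> forall i, x i = y i.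

Definition normset n (X : vec n -> Prop) u : Prop := exists x, X x /\ vnorm x = u.

Definition per_from y m (A : nat -> Prop) : Prop := forall u, y <= u -> (A u <-> A (u + m)).

Lemma per_from_mul y m A k : per_from y m A -> per_from y (k * m) A.
Proof.
move=> h; elim: k => [|k IH] u hu; first by rewrite addn0.
apply: (iff_trans (h u hu)); rewrite mulSn addnA; apply: IH; lia.
Qed.

(** The place where periodicity starts does not depend on the period. *)
Lemma per_from_of_per y m M A : 0 < m -> per_from y m A -> ultimately_m_periodic M A ->
  per_from y M A.
Proof.
move=> m0 h [t Ht] u hu; have hk := per_from_mul t h.
apply: (iff_trans (hk u hu)); apply: (iff_trans (Ht _ _)); first by nia.
by apply: iff_sym; rewrite -addnA [_ * _ + _]addnC addnA; apply: hk; lia.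
Qed.

Lemma per_from_hit y M A : 0 < M -> per_from y M A -> (forall b, exists u, b < u /\ A u) ->
  forall j, exists u, A u /\ y + j * M <= u < y + j.+1 * M.
Proof.
move=> M0 h unb j; have [u [hu Au]] := unb (y + j * M).
pose v := u - (y + j * M).
exists (y + j * M + v %% M); split; last by have := ltn_pmod v M0; rewrite mulSn; lia.
apply/(per_from_mul (v %/ M) h); first by lia.
suff -> : y + j * M + v %% M + v %/ M * M = u by [].
by have := divn_eq v M; rewrite /v; lia.
Qed.

Section Sparse.
Variable n : nat.
Variable O : env -> vec n -> Prop.

(** The instances with a given [s] depend on further parameters; only the least threshold
    among the sparse unbounded ones is a function of [s], to which linear growth applies. *)
Definition threshold s y : Prop := exists e,
  let X := O (scons s e) in
  [/\ sparse s X, ~ bounded X & exists m, 0 < m /\ per_from y m (normset X)].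

Definition least_threshold s y : Prop :=
  threshold s y /\ forall z, z < y -> ~ threshold s z.

Lemma least_threshold_uniq s y z : least_threshold s y -> least_threshold s z -> y = z.
Proof.
by move=> [h1 h2] [h3 h4]; case: (ltngtP y z) => // h; [case: (h4 y)|case: (h2 z)].
Qed.

(** From [y <= C * (s + 1)] on, each of the intervals of length [M] contains the norm of a point of
    the instance.  The first [K] of these points lie in a box of side less than [(C + 1) * (s + 1)],
    if [M * K <= s].  Cut the box into [(C + 1) ^ n < K] cubes of side [s + 1]: two of the points are
    in the same cube. *)
Lemma no_sparse_of_growth M C :
  0 < M -> (forall e, ultimately_m_periodic M (normset (O e))) ->
  (forall s y, least_threshold s y -> y <= C * s.+1) ->
  exists s0, forall e, s0 <= e 0 -> sparse (e 0) (O e) -> bounded (O e).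
Proof.
move=> M0 hM hC; pose K := (C.+1 ^ n).+1.
exists (M * K) => e hs sp; apply: NNPP => unb; set s := e 0 in hs sp.
have [y [[e1 [spX unbX [m [m0 hm]]]] hmin]] : exists y, least_threshold s y.
  apply: ex_least; have [t Ht] := hM e; exists t, (fun i => e i.+1).
  have -> : scons s (fun i => e i.+1) = e by apply: functional_extensionality => -[].
  by split=> //; exists M.
set X := O (scons s e1) in spX unbX hm.
have le_y : y <= C * s.+1.
  by apply: hC; split=> //; exists e1; split=> //; exists m.
have hX := per_from_of_per m0 hm (hM _).
have unbN b : exists u, b < u /\ normset X u.
  by have [x [Xx hx]] := unboundedP unbX b; exists (vnorm x); split=> //; exists x.
have pts (j : 'I_K) : exists x, X x /\ y + j * M <= vnorm x < y + j.+1 * M.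
  by have [u [[x [Xx <-]] hu]] := per_from_hit M0 hX unbN j; exists x.
have [x hx] := fin_all_exists pts.
(* The cube containing a point. *)
pose f (j : 'I_K) : {ffun 'I_n -> 'I_C.+1} := [ffun i => inord (x j i %/ s.+1)].
suff /leq_card : injective f by rewrite card_ffun !card_ord /K ltnn.
have xlt j i : x j i %/ s.+1 < C.+1.
  rewrite ltn_divLR //; have [_ /andP [_ lt_x]] := hx j.
  have /vnorm_leP /(_ i) le_x := leqnn (vnorm (x j)).
  have := ltn_ord j; nia.
move=> j k /ffunP Ejk.
have Ediv i : x j i %/ s.+1 = x k i %/ s.+1.
  by have := congr1 (@nat_of_ord _) (Ejk i); rewrite !ffunE !inordK.
have Ex : x j = x k.
  apply: functional_extensionality; apply: spX; [by case: (hx j)|by case: (hx k)|].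
  move=> i; have := divn_eq (x j i) s.+1; have := divn_eq (x k i) s.+1; rewrite Ediv.
  by have := ltn_pmod (x j i) (ltn0Sn s); have := ltn_pmod (x k i) (ltn0Sn s); lia.
apply: val_inj => /=; have [_ /andP [h1 h2]] := hx j; have [_ /andP [h3 h4]] := hx k.
rewrite Ex in h1 h2; case: (ltngtP j k) => // h; nia.
Qed.
End Sparse.

Section SparseForced.
Variable V : vocabulary.

Lemma no_sparse n (O : structure V -> env -> vec n -> Prop) : definable_vec O ->
  forced (fun S => exists s0, forall e, s0 <= e 0 -> sparse (e 0) (O S e) -> bounded (O S e)).
Proof.
move=> hO.
have hN : definable1 (fun S e => normset (O S e)).
  rewrite /definable1 /normset.
  apply: (@def_ext _ (fun S e => exists x : vec n, O S (fun i => e i.+1) x /\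
     ((forall i, x i <= e 0) /\ forall w, (forall i, x i <= w) -> e 0 <= w))).
    by move=> S e; split=> -[x [h1 h2]]; exists x; split=> //; apply/vnorm_eqP.
  sdef; exact: (fdef_ren (fun i => n + i.+1)).
have hS : definable1 (fun S e s => sparse s (O S (scons s e))).
  rewrite /definable1 /sparse; sdef.
  - apply: def_ext (fdef_ren (fun i => n + (n + i)) (fun i => n + i) hO) => S e /=.
    suff -> : scons (e (n + (n + 0))) (fun i => e (n + (n + i.+1))) = fun i => e (n + (n + i)) by [].
    by apply: functional_extensionality => -[].
  - apply: def_ext (fdef_ren (fun i => n + (n + i)) (fun i => i) hO) => S e /=.
    suff -> : scons (e (n + (n + 0))) (fun i => e (n + (n + i.+1))) = fun i => e (n + (n + i)) by [].
    by apply: functional_extensionality => -[].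
have hB : definable1 (fun S e s => bounded (O S (scons s e))).
  rewrite /definable1 /bounded.
  apply: (@def_ext _ (fun S e => exists b, forall x, O S (scons (e 0) (fun i => e i.+1)) x -> forall i, x i <= b)).
    by move=> S e; split=> -[b h]; exists b => x /h /vnorm_leP.
  sdef.
  apply: def_ext (fdef_ren (fun i => n + i.+1) (fun i => i) hO) => S e /=.
  suff -> : scons (e (n + 1)) (fun i => e (n + i.+2)) = fun i => e (n + i.+1) by [].
  by apply: functional_extensionality => -[].
have hN' : definable2 (fun S e s u => normset (O S (scons s e)) u).
  exact: (fdef_scons hN).
have hT : definable2 (fun S (_ : env) s y => threshold (O S) s y).
  apply: (fdef2_exenv (A := fun S e s y => let X := O S (scons s e) in
     [/\ sparse s X, ~ bounded X & exists m, 0 < m /\ per_from y m (normset X)])).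
  apply: (@def_ext _ (fun S e => sparse (e 0) (O S (scons (e 0) (fun i => e i.+2))) /\
     (~ bounded (O S (scons (e 0) (fun i => e i.+2))) /\
       exists m, 0 < m /\ per_from (e 1) m (normset (O S (scons (e 0) (fun i => e i.+2))))))).
    by move=> S e; split=> [[h1 [h2 h3]]|[h1 h2 h3]].
  rewrite /per_from; sdef.
  - exact: (fdef1_subst (fun i => i.+2) hS (tdef_var _ 0)).
  - exact: (fdef1_subst (fun i => i.+2) hB (tdef_var _ 0)).
  - exact: (fdef2_subst (fun i => i.+4) hN' (tdef_var _ 2) (tdef_var _ 0)).
  - exact: (fdef2_subst (fun i => i.+4) hN' (tdef_var _ 2) (tdef_add (tdef_var _ 0) (tdef_var _ 1))).
have hL : definable2 (fun S (_ : env) s y => least_threshold (O S) s y).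
  rewrite /definable2 /least_threshold; sdef.
  by apply: (fdef2_subst (fun i => i.+3) hT); sdef.
apply: forced_weaken (forced_and (bounded_period hN) (linear_growth hL)).
move=> S [[M [M0 hM]] /(_ (fun => 0)) []]; last first.
  by move=> C hC; apply: (no_sparse_of_growth M0 hM hC).
move=> s; case: (classic (exists y, least_threshold (O S) s y)) => [[y hy]|H].
  by exists y => z /(least_threshold_uniq hy) ->.
by exists 0 => y hy; case: H; exists y.
Qed.

(** The translation is given as a difference [p - q] of natural vectors; [w] is the translate of
    [y], where it has natural coordinates. *)
Definition aperiodic n (R : vec n -> Prop) s k (x : vec n) : Prop :=
  forall p q : vec n, (forall i, p i <= s) -> (forall i, q i <= s) -> ~ (forall i, p i = q i) ->
  exists y : vec n, ((forall i, x i <= y i) /\ (forall i, y i <= x i + k)) /\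
  exists w : vec n, (forall i, y i + p i = w i + q i) /\ ~ (R y <-> R w).

Definition same_pattern n (R : vec n -> Prop) k (x x' : vec n) : Prop :=
  forall z : vec n, (forall i, z i <= k) -> (R (fun i => x i + z i) <-> R (fun i => x' i + z i)).

(** Two occurrences of a pattern make their difference a period of it. *)
Lemma aperiodic_sparse n (R : vec n -> Prop) s k x0 :
  sparse s (fun x => aperiodic R s k x /\ same_pattern R k x0 x).
Proof.
move=> x y [ax px] [ay py] hxy; apply: NNPP => neq.
pose e i := minn (x i) (y i).
have [] := ax (fun i => y i - e i) (fun i => x i - e i).
- by move=> i; have := hxy i; rewrite /e; lia.
- by move=> i; have := hxy i; rewrite /e; lia.
- by move=> H; apply: neq => i; have := H i; rewrite /e; lia.
move=> u [[h1 h2] [w [h3]]]; apply.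
pose z i := u i - x i.
have -> : u = fun i => x i + z i by apply: functional_extensionality => i; rewrite /z; have := h1 i; lia.
have -> : w = fun i => y i + z i.
  by apply: functional_extensionality => i; rewrite /z; have := h1 i; have := h3 i; rewrite /e; lia.
have hz i : z i <= k by rewrite /z; have := h2 i; lia.
by apply: (iff_trans (iff_sym (px z hz))); apply: py.
Qed.

(** There are finitely many patterns of a given size. *)
Lemma pattern_pigeonhole n (R : vec n -> Prop) k (X : vec n -> Prop) :
  ~ bounded X -> exists x0, ~ bounded (fun x => X x /\ same_pattern R k x0 x).
Proof.
move=> unb; apply: NNPP => H.
have {}H x0 : bounded (fun x => X x /\ same_pattern R k x0 x).
  by apply: NNPP => H'; apply: H; exists x0.
pose T := {ffun 'I_n -> 'I_k.+1}.
pose of_pattern (b : {ffun T -> bool}) (x : vec n) :=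
  forall z : T, b z <-> R (fun i => x i + z i).
have bnd (b : {ffun T -> bool}) : bounded (fun x => X x /\ of_pattern b x).
  case: (classic (exists x0, of_pattern b x0)) => [[x0 h0]|H']; last first.
    by exists 0 => x [_ hx]; case: H'; exists x.
  have [B HB] := H x0; exists B => x [Xx hx]; apply: HB; split=> // z hz.
  pose z' : T := [ffun i => inord (z i)].
  have -> : z = fun i => z' i.
    by apply: functional_extensionality => i; rewrite ffunE inordK // ltnS.
  by apply: (iff_trans (iff_sym (h0 z'))).
have [B HB] := fin_all_exists bnd.
apply: unb; exists (\max_b B b) => x Xx.
have [f hf] : exists f : T -> bool, forall z, f z <-> R (fun i => x i + z i).
  apply: (@fin_all_exists _ _ (fun (z : T) (c : bool) => c <-> R (fun i => x i + z i))) => z.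
  by case: (classic (R (fun i => x i + z i))) => h; [exists true|exists false].
apply: leq_trans (leq_bigmax (finfun f)); apply: HB.
by split=> // z; rewrite ffunE.
Qed.

(** Infinitely many aperiodic boxes would contain infinitely many occurrences of the same pattern,
    and these are sparse.  The box size and the pattern are parameters of the family to which
    [no_sparse] applies, so that [s] does not depend on them. *)
Lemma locally_periodic n (F : structure V -> env -> vec n -> Prop) : definable_vec F ->
  forced (fun S => exists s, forall e k, bounded (aperiodic (F S e) s k)).
Proof.
move=> hF.
(* The assignment lists [s], [k], the position of the reference pattern and the parameters
   of [F]. *)
pose O S (e : env) (x : vec n) := let R := F S (fun i => e (n + i).+2) in
  aperiodic R (e 0) (e 1) x /\ same_pattern R (e 1) (fun i => e i.+2) x.
have hO : definable_vec O.
  rewrite /definable_vec /O /aperiodic /same_pattern; sdef.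
  - exact: (fdef_ren (fun i => n + (n + (n + (n + (n + (n + i).+2))))) (fun i => n + i) hF).
  - exact: (fdef_ren (fun i => n + (n + (n + (n + (n + (n + i).+2))))) (fun i => i) hF).
  - by apply: (fdef_subst (fun i => n + (n + (n + i).+2)) hF) => i; sdef.
  - by apply: (fdef_subst (fun i => n + (n + (n + i).+2)) hF) => i; sdef.
apply: forced_weaken (no_sparse hO) => S [s Hs]; exists s => e k; apply: NNPP => unb.
have [x0 Hx0] := pattern_pigeonhole (F S e) k unb; apply: Hx0.
pose e' := scons s (scons k (vapp x0 e)).
have := Hs e' (leqnn s).
have -> : O S e' = fun x => aperiodic (F S e) s k x /\ same_pattern (F S e) k x0 x.
  rewrite /O.
  have -> : (fun i => e' (n + i).+2) = e by exact: vapp_r.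
  by have -> : (fun i : 'I_n => e' i.+2) = x0 by exact: vapp_l.
by apply; apply: aperiodic_sparse.
Qed.

End SparseForced.

(** * Presburger-definable sets depend on signs and residues *)

(** Linear forms, with the coefficients listed in the order of the variables. *)
Fixpoint lin (a : seq Z) (e : env) : Z :=
  match a with
  | [::] => 0%Z
  | b :: a' => (b * (e 0%N)%:z + lin a' (fun i => e i.+1))%Z
  end.

Definition form : Type := Z * seq Z.

Definition ev (l : form) (e : env) : Z := (l.1 + lin l.2 e)%Z.

Fixpoint lin_add (a b : seq Z) : seq Z :=
  match a, b with
  | [::], _ => b
  | _, [::] => a
  | x :: a', y :: b' => (x + y)%Z :: lin_add a' b'
  end.

Definition fadd (l k : form) : form := ((l.1 + k.1)%Z, lin_add l.2 k.2).
Definition fscale c (l : form) : form := ((c * l.1)%Z, [seq (c * x)%Z | x <- l.2]).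
Definition fconst c : form := (c, [::]).

Lemma ev_add l k e : ev (fadd l k) e = (ev l e + ev k e)%Z.
Proof.
suff E : lin (lin_add l.2 k.2) e = (lin l.2 e + lin k.2 e)%Z by rewrite /ev /= E; lia.
elim: l.2 k.2 e => [|x a IH] [|y b] e //=; rewrite ?IH; lia.
Qed.

Lemma ev_scale c l e : ev (fscale c l) e = (c * ev l e)%Z.
Proof.
suff E : lin [seq (c * x)%Z | x <- l.2] e = (c * lin l.2 e)%Z by rewrite /ev /= E; lia.
elim: l.2 e => [|x a IH] e //=; rewrite ?IH; lia.
Qed.

Lemma ev_const c e : ev (fconst c) e = c.
Proof. by rewrite /ev /=; lia. Qed.

Definition cong (m a b : Z) : Prop := (m | a - b)%Z.

Lemma lin_cong m a e e' : (forall i, cong m (e i)%:z (e' i)%:z) -> cong m (lin a e) (lin a e').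
Proof.
elim: a e e' => [|b a IH] e e' h /=; first by exists 0%Z; lia.
have [k Hk] := IH (fun i => e i.+1) (fun i => e' i.+1) (fun i => h i.+1).
by have [j Hj] := h 0; exists (b * j + k)%Z; lia.
Qed.

Lemma ev_cong m l e e' : (forall i, cong m (e i)%:z (e' i)%:z) -> cong m (ev l e) (ev l e').
Proof. by move/lin_cong => /(_ l.2) [k Hk]; exists k; rewrite /ev; lia. Qed.

Definition agree (L : seq form) (m : Z) (e e' : env) : Prop :=
  (forall l, List.In l L -> (0 < ev l e)%Z <-> (0 < ev l e')%Z) /\
  (forall i, cong m (e i)%:z (e' i)%:z).

Lemma agree_sym L m e e' : agree L m e e' -> agree L m e' e.
Proof.
case=> h1 h2; split=> [l /h1 -> //|i].
by have [k Hk] := h2 i; exists (- k)%Z; lia.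
Qed.

Lemma agree_sub L L' m m' e e' : (forall l, List.In l L -> List.In l L') -> (m | m')%Z ->
  agree L' m' e e' -> agree L m e e'.
Proof.
move=> hL hm [h1 h2]; split=> [l /hL /h1 //|i].
exact: Z.divide_trans (h2 i).
Qed.

(** Semantic counterpart of quantifier-free formulas of Presburger arithmetic. *)
Definition determined (P : env -> Prop) : Prop :=
  exists L m, (0 < m)%Z /\ forall e e', agree L m e e' -> P e -> P e'.

Lemma determined_ext P Q : (forall e, P e <-> Q e) -> determined P -> determined Q.
Proof.
move=> PQ [L [m [m0 H]]]; exists L, m; split=> // e e' /H h.
by move/PQ/h/PQ.
Qed.

Lemma determined_not P : determined P -> determined (fun e => ~ P e).
Proof.
by move=> [L [m [m0 H]]]; exists L, m; split=> // e e' /agree_sym /H h nP /h.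
Qed.

Lemma determined_and P Q : determined P -> determined Q -> determined (fun e => P e /\ Q e).
Proof.
move=> [L [m [m0 H]]] [L' [m' [m0' H']]].
exists (L ++ L')%list, (m * m')%Z; split; first by lia.
move=> e e' hag [hP hQ]; split.
- apply: H hP; apply: agree_sub hag; first by move=> l hl; apply/List.in_app_iff; left.
  by exists m'; lia.
- apply: H' hQ; apply: agree_sub hag; first by move=> l hl; apply/List.in_app_iff; right.
  by exists m; lia.
Qed.

Lemma determined_or P Q : determined P -> determined Q -> determined (fun e => P e \/ Q e).
Proof.
move=> hP hQ; apply: determined_ext (determined_not (determined_and (determined_not hP) (determined_not hQ))) => e.
by tauto.
Qed.

Lemma determined_pos l : determined (fun e => (0 < ev l e)%Z).
Proof.
by exists [:: l], 1%Z; split=> // e e' [h _] /h; apply; left.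
Qed.

Lemma scale_lt b c x y : (0 < b)%Z -> (b * x < c * (b * y))%Z <-> (x < c * y)%Z.
Proof. by move=> b0; rewrite [(c * _)%Z]Z.mul_shuffle3 -Z.mul_lt_mono_pos_l. Qed.

(** Multiplying forms by constants gives the first variable [z] the same coefficient [c] wherever it
    occurs; each form then either omits [z] or compares [c * z] with a form in the other
    variables. *)
Lemma isolate (L : seq form) : exists (A L0 : seq form) (c : Z), (0 < c)%Z /\
  forall z z' e e',
    (forall a, List.In a A -> (ev a e < c * z%:z)%Z <-> (ev a e' < c * z'%:z)%Z) ->
    (forall l, List.In l L0 -> (0 < ev l e)%Z <-> (0 < ev l e')%Z) ->
    forall l, List.In l L -> (0 < ev l (scons z e))%Z <-> (0 < ev l (scons z' e'))%Z.
Proof.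
elim: L => [|[k0 a0] L [A [L0 [c [c0 H]]]]].
  by exists [::], [::], 1%Z; split.
pose b := if a0 is b :: _ then b else 0%Z.
pose l' : form := (k0, behead a0).
have evE z e : ev (k0, a0) (scons z e) = (b * z%:z + ev l' e)%Z.
  rewrite /ev /b /l'; case: (a0) => [|x a] /=; first lia.
  by have -> : lin a (fun i => e i) = lin a e by []; lia.
case: (Z.lt_trichotomy b 0) => [hb|[hb|hb]].
- exists (fadd (fscale c l') (fconst (-1)) :: map (fscale (- b)) A), L0, (c * - b)%Z.
  split; first by nia.
  move=> z z' e e' hA hL0 l [<-|hl].
    rewrite !evE; have := hA _ (or_introl erefl); rewrite !ev_add !ev_scale !ev_const.
    move: (ev l' e) (ev l' e') => u v h; split=> h1; apply: Znot_ge_lt => h2.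
      by have /h : (c * u + -1 < c * - b * z%:z)%Z; nia.
    by have /h : (c * v + -1 < c * - b * z'%:z)%Z; nia.
  apply: (H z z' e e') => // a ha.
  have := hA (fscale (- b) a) (or_intror (List.in_map _ _ _ ha)).
  by rewrite !ev_scale -!Z.mul_assoc !scale_lt //; lia.
- exists A, (l' :: L0), c; split=> // z z' e e' hA hL0 l [<-|hl].
    by rewrite !evE hb /=; apply: hL0; left.
  by apply: (H z z' e e') => // k hk; apply: hL0; right.
- exists (fscale (- c) l' :: map (fscale b) A), L0, (c * b)%Z.
  split; first by nia.
  move=> z z' e e' hA hL0 l [<-|hl].
    rewrite !evE; have := hA _ (or_introl erefl); rewrite !ev_scale.
    by move: (ev l' e) (ev l' e') => u v; nia.
  apply: (H z z' e e') => // a ha.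
  have := hA (fscale b a) (or_intror (List.in_map _ _ _ ha)).
  by rewrite !ev_scale -!Z.mul_assoc !scale_lt //; lia.
Qed.

(** The signs of these forms record the order of the values of [a + r] and [b]. *)
Definition comparisons (A : seq form) (k : nat) : seq form :=
  List.flat_map (fun a => List.flat_map (fun b =>
    List.map (fun r => fadd (fadd a (fconst r%:z)) (fscale (-1) b)) (List.seq 0 k)) A) A.

Lemma comparisonsP A k e e' :
  (forall l, List.In l (comparisons A k) -> (0 < ev l e)%Z <-> (0 < ev l e')%Z) ->
  forall a b (r : Z), List.In a A -> List.In b A -> (0 <= r < k%:z)%Z ->
  (ev b e < ev a e + r)%Z <-> (ev b e' < ev a e' + r)%Z.
Proof.
move=> h a b r ha hb hr.
have := h (fadd (fadd a (fconst (Z.to_nat r)%:z)) (fscale (-1) b)).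
rewrite !ev_add !ev_scale !ev_const.
have Er : (Z.to_nat r)%:z = r by lia.
move: (ev a e) (ev a e') (ev b e) (ev b e') => x x' y y' H.
suff hin : List.In (fadd (fadd a (fconst (Z.to_nat r)%:z)) (fscale (-1) b)) (comparisons A k).
  by have := H hin; lia.
apply/List.in_flat_map; exists a; split=> //.
apply/List.in_flat_map; exists b; split=> //.
apply: (List.in_map (fun s : nat => fadd (fadd a (fconst s%:z)) (fscale (-1) b))).
by apply/List.in_seq; lia.
Qed.

(** Cooper's argument.  Decreasing a witness [z] by [m] is harmless as long as [c * z] stays above the
    same forms, so [z] can be taken with [c * z = a + r], for one of the forms [a] and
    [0 < r <= m * c]; the form -1 plays the role of a lower bound.  The same [a] and [r] then give a
    witness for the other assignment, because the signs of [a + r - b] and the residues modulo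
    [m * c] agree. *)
Lemma determined_ex (P : env -> Prop) : determined P ->
  determined (fun e => exists z, P (scons z e)).
Proof.
move=> [L [m [m0 H]]]; have [A [L0 [c [c0 HA]]]] := isolate L.
pose A1 := fconst (-1) :: A.
exists (L0 ++ comparisons A1 (Z.to_nat (m * c + 1)))%list, (m * c)%Z; split; first by nia.
move=> e e' [hag1 hag2] [z0 Hz0].
have hgap := comparisonsP (fun l hl => hag1 l (proj2 (List.in_app_iff _ _ _) (or_intror hl))).
have hL0 l (hl : List.In l L0) := hag1 l (proj2 (List.in_app_iff _ _ _) (or_introl hl)).
have m1A : List.In (fconst (-1)) A1 by left.
have mc0 : (0 < m * c)%Z by nia.
have [z [Hz [a [ha hza]]]] : exists z, P (scons z e) /\ exists a, List.In a A1 /\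
    (ev a e < c * z%:z <= ev a e + m * c)%Z.
  elim/ltn_ind: z0 Hz0 => z IH Hz.
  case: (classic (exists a, List.In a A1 /\ (ev a e < c * z%:z <= ev a e + m * c)%Z)).
    by move=> ha; exists z.
  move=> na; have {}na a : List.In a A1 -> (ev a e < c * z%:z)%Z -> (ev a e + m * c < c * z%:z)%Z.
    by move=> ha h; apply: Znot_ge_lt => h'; apply: na; exists a; split=> //; lia.
  have zm : (m <= z%:z)%Z by have := na _ m1A; rewrite ev_const => h; have := h ltac:(nia); nia.
  have Ez : (z - Z.to_nat m)%:z = (z%:z - m)%Z by lia.
  apply: (IH (z - Z.to_nat m)); first by lia.
  apply: H Hz; split; last first.
    case=> [|i] /=; last by exists 0%Z; lia.
    by rewrite /= Ez; exists 1%Z; lia.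
  apply: HA => // a ha; rewrite Ez.
  by have := na a (or_intror ha); move: (ev a e) => u; nia.
have [k Hk] := ev_cong a hag2.
pose r := (c * z%:z - ev a e)%Z.
have hr : (0 <= r < (Z.to_nat (m * c + 1))%:z)%Z by rewrite /r; lia.
have Er : (ev a e + r = c * z%:z)%Z by rewrite /r; lia.
have Er' : (ev a e' + r = c * (z%:z - m * k))%Z by rewrite /r; nia.
have z'0 : (0 <= z%:z - m * k)%Z.
  have := hgap a _ r ha m1A hr; rewrite Er Er' !ev_const => -[/(_ ltac:(nia)) h _].
  by nia.
exists (Z.to_nat (z%:z - m * k)%Z).
have Ez' : (Z.to_nat (z%:z - m * k)%Z)%:z = (z%:z - m * k)%Z by lia.
apply: H Hz; split; last first.
  case=> [|i]; first by rewrite /= Ez'; exists k; lia.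
  by have [j Hj] := hag2 i; exists (j * c)%Z; rewrite /=; lia.
apply: HA => // b hb; rewrite Ez' -Er' -Er.
by apply: hgap => //; right.
Qed.

Lemma ev_term n (t : term n) : exists l, forall e, (eval (restrict n e) t)%:z = ev l e.
Proof.
elim: t => [i|t1 [l1 H1] t2 [l2 H2]].
  exists (0%Z, ncons i 0%Z [:: 1%Z]) => e; rewrite /= tnth_mktuple /ev /=.
  elim: (nat_of_ord i) e => [|k IH] e.
    by change ((e 0%N)%:z = 0 + (1 * (e 0%N)%:z + 0))%Z; lia.
  exact: (IH (fun i => e i.+1)).
by exists (fadd l1 l2) => e; rewrite ev_add -H1 -H2 /=; lia.
Qed.

Lemma formula_inv n (phi : formula voc_add_lt n) :
  determined (fun e => sat nat_add_lt phi (restrict n e)).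
Proof.
elim: phi => {n}
  [n t1 t2|n t1 t2|n r ts|n p IH|n p IHp q IHq|n p IHp q IHq|n p IHp q IHq|n p IH|n p IH].
- have [[l1 H1] [l2 H2]] := (ev_term t1, ev_term t2).
  apply: (@determined_ext (fun e => ~ (0 < ev (fadd l1 (fscale (-1) l2)) e)%Z /\
                             ~ (0 < ev (fadd l2 (fscale (-1) l1)) e)%Z)).
    by move=> e /=; rewrite !ev_add !ev_scale -H1 -H2; lia.
  by apply: determined_and; apply: determined_not; apply: determined_pos.
- have [[l1 H1] [l2 H2]] := (ev_term t1, ev_term t2).
  apply: (@determined_ext (fun e => (0 < ev (fadd l2 (fscale (-1) l1)) e)%Z)).
    by move=> e /=; rewrite !ev_add !ev_scale -H1 -H2; lia.
  exact: determined_pos.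
- by case: r ts.
- exact: determined_not.
- exact: determined_and.
- exact: determined_or.
- apply: (determined_ext _ (determined_or (determined_not IHp) IHq)) => e /=.
  by split=> [[h1 h2|h _ //]|h]; [case: h1|case: (classic (sat nat_add_lt p (restrict n e))); auto].
- apply: (determined_ext _ (determined_ex IH)) => e /=.
  by split=> -[a h]; exists a; move: h; rewrite restrict_scons.
- apply: (determined_ext _ (determined_not (determined_ex (determined_not IH)))) => e /=.
  split=> [h a|h [a]]; last by rewrite -restrict_scons.
  by apply: NNPP => na; apply: h; exists a; rewrite -restrict_scons.
Qed.

Lemma def_inv (P : structure voc_add_lt -> env -> Prop) : definable P -> determined (P nat_add_lt).
Proof. by case=> n [phi H]; apply: determined_ext (formula_inv phi) => e; apply: H. Qed.

(** On constant assignments every form has eventually a constant sign. *)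
Lemma determined_UP (P : env -> Prop) : determined P -> ultimately_periodic (fun x => P (fun => x)).
Proof.
move=> [L [m [m0 H]]]; exists (Z.to_nat m); split; first by lia.
have [t Ht] : exists t : nat, forall l, List.In l L -> forall x y : nat, t <= x -> t <= y ->
    (0 < ev l (fun => x))%Z -> (0 < ev l (fun => y))%Z.
  elim: L {H} => [|[k a] L [t Ht]]; first by exists 0.
  pose s := lin a (fun => 1).
  have evE x : ev (k, a) (fun => x) = (k + s * x%:z)%Z.
    rewrite /ev /s /=; suff -> : lin a (fun => x) = (lin a (fun => 1%N) * x%:z)%Z by [].
    by elim: a {s Ht} => [|b a IH] /=; rewrite ?IH; lia.
  exists (t + Z.to_nat (Z.abs k) + 1) => l [<-|hl] x y hx hy; last by apply: Ht => //; lia.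
  rewrite !evE; have hx' : (Z.abs k < x%:z)%Z by lia.
  have hy' : (Z.abs k < y%:z)%Z by lia.
  case: (Z.lt_trichotomy s 0) => [hs|[->|hs]]; [nia|lia|nia].
exists t => x hx; split; apply: H; split=> [l hl|i].
- by split; apply: Ht => //; lia.
- by exists (-1)%Z; lia.
- by split; apply: Ht => //; lia.
- by exists 1%Z; lia.
Qed.

Lemma definable_UP (X : 1.-tuple nat -> Prop) : FO_add_lt_definable X ->
  ultimately_periodic (fun n => X [tuple n]).
Proof.
case=> phi H; apply: UP_ext (determined_UP (formula_inv phi)) => x.
rewrite H /defined_set; suff -> : [tuple x] = restrict 1 (fun => x) by [].
by apply: eq_from_tnth => i; rewrite tnth_mktuple (tnth_nth 0) (ord1 i).
Qed.

(** * Integrating a difference operator *)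

(** Definability from addition and order alone, in the vocabulary without further relations. *)
Definition presburger n (X : vec n -> Prop) : Prop :=
  definable_vec (fun (_ : structure voc_add_lt) (_ : env) => X).

Lemma presb_ext n (X Y : vec n -> Prop) : (forall x, X x <-> Y x) -> presburger X -> presburger Y.
Proof. by move=> XY; apply: def_ext => S e; apply: XY. Qed.

Lemma presb_subst n (X : vec n -> Prop) (t : 'I_n -> structure voc_add_lt -> env -> nat) :
  presburger X -> (forall i, definable_fun (t i)) -> definable (fun S e => X (fun i => t i S e)).
Proof. exact: (@fdef_subst _ _ (fun _ _ => X) (fun i => i)). Qed.

Section FiniteZ.
Variable V : vocabulary.

Lemma tdef_sub (t u : structure V -> env -> nat) : definable_fun t -> definable_fun u ->
  definable_fun (fun S e => t S e - u S e).
Proof.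
move=> ht hu; have ht' := tdef_shift ht; have hu' := tdef_shift hu.
apply: (@def_ext _ (fun S e => (u S (fun i => e i.+1) <= t S (fun i => e i.+1) /\
     e 0 + u S (fun i => e i.+1) = t S (fun i => e i.+1)) \/
   (t S (fun i => e i.+1) <= u S (fun i => e i.+1) /\ e 0 = 0))).
  by move=> S e; lia.
by sdef.
Qed.

Lemma def_exF (T : finType) (P : T -> structure V -> env -> Prop) :
  (forall i, definable (P i)) -> definable (fun S e => exists i, P i S e).
Proof.
move=> hP; apply: (@def_ext _ (fun S e => ~ forall i, ~ P i S e)).
  by move=> S e; split=> [/not_all_ex_not [i /NNPP]|[i Hi] H]; [exists i|exact: (H i)].
by apply: def_not; apply: def_allF => i; apply: def_not.
Qed.

Lemma def_exZ B (P : Z -> structure V -> env -> Prop) :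
  (forall c, definable (P c)) -> definable (fun S e => exists c, (Z.abs c <= B)%Z /\ P c S e).
Proof.
move=> hP; pose N := Z.to_nat (2 * B + 1).
apply: (@def_ext _ (fun S e => exists k : 'I_N, P (k%:z - B)%Z S e)); last exact: def_exI.
move=> S e; split=> [[k hk]|[c [hc h]]].
  by exists (k%:z - B)%Z; split=> //; have := ltn_ord k; rewrite /N; lia.
have lt_c : Z.to_nat (c + B) < N by rewrite /N; lia.
exists (Ordinal lt_c) => /=.
by have -> : ((Z.to_nat (c + B))%:z - B = c)%Z by lia.
Qed.
End FiniteZ.

Definition boundedZ n (g : vec n -> Z) : Prop := exists B, forall x, (Z.abs (g x) <= B)%Z.
Definition presburger_levels n (g : vec n -> Z) : Prop := forall c, presburger (fun x => g x = c).
Definition presburger_sections n (g : vec n -> Z) : Prop :=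
  forall i v c, presburger (fun x => x i = v /\ g x = c).

Definition vadd n (x y : vec n) : vec n := fun i => x i + y i.
Definition difference n (p q : vec n) (g : vec n -> Z) : vec n -> Z :=
  fun y => (g (vadd y p) - g (vadd y q))%Z.

Lemma boundedZ_diff n (p q : vec n) g : boundedZ g -> boundedZ (difference p q g).
Proof.
move=> [B hB]; exists (2 * B)%Z => x; rewrite /difference.
by have := hB (vadd x p); have := hB (vadd x q); lia.
Qed.

Lemma sections_diff n (p q : vec n) g : boundedZ g -> presburger_sections g ->
  presburger_sections (difference p q g).
Proof.
move=> [B hB] hg i v c.
apply: (@def_ext _ (fun S e => exists b, (Z.abs b <= B)%Z /\
  ((vadd (fun j : 'I_n => e j) p i = v + p i /\ g (vadd (fun j : 'I_n => e j) p) = b) /\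
   (vadd (fun j : 'I_n => e j) q i = v + q i /\ g (vadd (fun j : 'I_n => e j) q) = (b - c)%Z)))).
  move=> S e; rewrite /difference /vadd; split=> [[b [_ [[h1 h2] [h3 h4]]]]|[h1 h2]].
    by split; lia.
  exists (g (vadd (fun j : 'I_n => e j) p)); split; first exact: hB.
  by rewrite /vadd; do 3 (split; try lia).
apply: def_exZ => b; apply: def_and.
- apply: (presb_subst (t := fun j S e => e j + p j) (hg i (v + p i) b)) => j; sdef.
- apply: (presb_subst (t := fun j S e => e j + q j) (hg i (v + q i) (b - c)%Z)) => j; sdef.
Qed.

(** Finitely many values, so one list of forms and one modulus serve for all level sets. *)
Lemma levels_inv n (h : vec n -> Z) : boundedZ h -> presburger_levels h ->
  exists L m, 0 < m /\ forall e e', agree L m%:z e e' ->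
    h (fun i : 'I_n => e i) = h (fun i : 'I_n => e' i).
Proof.
move=> [B hB] hh.
have inv c : determined (fun e => h (fun i : 'I_n => e i) = c) by have := def_inv (hh c).
have [L [m [m0 H]]] : exists L m, (0 < m)%Z /\ forall k, k < (Z.to_nat (2 * B + 1)) ->
    forall e e', agree L m e e' -> h (fun i : 'I_n => e i) = (k%:z - B)%Z ->
    h (fun i : 'I_n => e' i) = (k%:z - B)%Z.
  elim: (Z.to_nat (2 * B + 1)) => [|N [L [m [m0 H]]]]; first by exists [::], 1%Z.
  have [L' [m' [m0' H']]] := inv (N%:z - B)%Z.
  exists (L ++ L')%list, (m * m')%Z; split; first by lia.
  move=> k; rewrite ltnS leq_eqVlt => /orP [/eqP ->|hk] e e' hag.
    apply: H'; apply: agree_sub hag; first by move=> l hl; apply/List.in_app_iff; right.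
    by exists m; lia.
  apply: (H k hk); apply: agree_sub hag; first by move=> l hl; apply/List.in_app_iff; left.
  by exists m'; lia.
exists L, (Z.to_nat m); split; first by lia.
move=> e e'; have -> : (Z.to_nat m)%:z = m by lia.
move=> hag; set a := h _; have := hB (fun i : 'I_n => e i); rewrite -/a => ha.
by have := H (Z.to_nat (a + B)) ltac:(lia) e e' hag; rewrite -/a => ->; lia.
Qed.

Section Integration.
Variable n : nat.
Variables (g : vec n -> Z) (p q : vec n) (B : nat) (i0 : 'I_n).
Hypothesis gB : forall x, (Z.abs (g x) <= B%:z)%Z.
Hypothesis lt_qp : q i0 < p i0.
Let h := difference p q g.
Hypothesis hh : presburger_levels h.
Hypothesis hg : presburger_sections g.
Variables (L : seq form) (m : nat).
Hypothesis m0 : 0 < m.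
Hypothesis hinv : forall e e', agree L m%:z e e' ->
    h (fun i : 'I_n => e i) = h (fun i : 'I_n => e' i).

(** The points x, x - p + q, x - 2p + 2q, and so on form a chain, which is continued as long as the
    current point dominates [p].  It decreases in the coordinate [i0], so it ends, at a point
    having a coordinate [i] less than [p i]. *)
Definition can_step x k : Prop := forall i : 'I_n, p i + p i * k <= x i + q i * k.
Definition chain_pt (x : vec n) k : vec n := fun i => x i + q i * k - p i * k.
(** The argument at which [h] is the difference of [g] along the [k]-th step. *)
Definition chain_base (x : vec n) k : vec n := fun i => x i + q i * k - (p i + p i * k).
Definition can_step_upto x l : Prop := forall k, k < l -> can_step x k.

Lemma chain_pt0 x : chain_pt x 0 = x.
Proof. by apply: functional_extensionality => i; rewrite /chain_pt; lia. Qed.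

Lemma g_step x k : can_step x k -> g (chain_pt x k) = (h (chain_base x k) + g (chain_pt x k.+1))%Z.
Proof.
move=> hk; rewrite /h /difference.
have -> : vadd (chain_base x k) p = chain_pt x k.
  by apply: functional_extensionality => i; have := hk i; rewrite /vadd /chain_base /chain_pt; lia.
have -> : vadd (chain_base x k) q = chain_pt x k.+1; last by lia.
by apply: functional_extensionality => i; have := hk i; rewrite /vadd /chain_base /chain_pt; lia.
Qed.

Lemma chain_pt_le x l : can_step_upto x l -> forall i, p i * l <= x i + q i * l.
Proof.
by case: l => [|l] H i; [lia|have := H l (ltnSn l) i; lia].
Qed.

Lemma chain_pt_add x k l : can_step_upto x k -> chain_pt (chain_pt x k) l = chain_pt x (k + l).
Proof.
move=> hk; apply: functional_extensionality => i; have := chain_pt_le hk i.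
by rewrite /chain_pt; lia.
Qed.

Lemma chain_base_add x k l :
  can_step_upto x k -> chain_base (chain_pt x k) l = chain_base x (k + l).
Proof.
move=> hk; apply: functional_extensionality => i; have := chain_pt_le hk i.
by rewrite /chain_pt /chain_base; lia.
Qed.

Lemma can_step_add x k l : can_step_upto x k -> can_step (chain_pt x k) l <-> can_step x (k + l).
Proof.
move=> hk; split=> H i; have := H i; have := chain_pt_le hk i; rewrite /chain_pt; lia.
Qed.

(** A jump covers more than [2 * B] periods of [h].  The sum of [h] over these periods is a
    difference of two values of [g], at most [2 * B] in absolute value, so it is zero. *)
Definition jump x y : Prop := exists j,
  2 * B < j /\ can_step_upto x (m * j) /\ (forall i, y i = chain_pt x (m * j) i) /\
  forall k, k + m < m * j -> h (chain_base x k) = h (chain_base x (k + m)).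

(** [reach N x c] finds the value [c] of [g] at [x] by at most [N] jumps and single steps to the end
    of the chain. *)
Fixpoint reach N x c : Prop :=
  if N is N'.+1 then
    reach N' x c \/ (exists y : vec n, jump x y /\ reach N' y c) \/
    (can_step x 0 /\ exists b, (Z.abs b <= (2 * B)%N%:z)%Z /\ h (chain_base x 0) = b /\
      reach N' (chain_pt x 1) (c - b)%Z)
  else ~ can_step x 0 /\ g x = c.

Lemma g_block x l : can_step_upto x (l + m) ->
  (forall k, k < l -> h (chain_base x k) = h (chain_base x (k + m))) ->
  (g (chain_pt x l) - g (chain_pt x (l + m)) = g (chain_pt x 0) - g (chain_pt x m))%Z.
Proof.
elim: l => [|l IH] hok hper; first by rewrite add0n.
have /IH : can_step_upto x (l + m) by move=> k hk; apply: hok; lia.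
move=> /(_ (fun k hk => hper k (ltnW hk))) <-.
have h1 := g_step (hok l ltac:(lia)); have h2 := g_step (hok (l + m) ltac:(lia)).
have := hper l (ltnSn l); rewrite addSn; lia.
Qed.

Lemma jump_g x y : jump x y -> g x = g y.
Proof.
move=> [j [hj [hok [hy hper]]]].
have -> : y = chain_pt x (m * j) by apply: functional_extensionality.
pose D := (g (chain_pt x 0) - g (chain_pt x m))%Z.
have blocks i : i <= j -> (g (chain_pt x 0) - g (chain_pt x (m * i)) = i%:z * D)%Z.
  elim: i => [|i IH] hi; first by rewrite muln0; lia.
  have := IH (ltnW hi).
  have := @g_block x (m * i); rewrite -/D.
  have -> : m * i + m = m * i.+1 by rewrite mulnS addnC.
  have le_mj : m * i.+1 <= m * j by rewrite leq_mul2l hi orbT.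
  move=> /(_ (fun k hk => hok k (leq_trans hk le_mj))) hb hi'.
  have {}hb := hb (fun k hk => hper k ltac:(lia)); lia.
have := blocks j (leqnn j); have := @gB (chain_pt x 0); have := @gB (chain_pt x (m * j)).
rewrite chain_pt0 => h1 h2 h3.
have : (D = 0)%Z by nia.
by move=> D0; rewrite D0 in h3; lia.
Qed.

Lemma reach_sound N x c : reach N x c -> g x = c.
Proof.
elim: N x c => [|N IH] x c /=; first by case.
case=> [/IH //|[[y [/jump_g -> /IH //]]|[hx [b [_ [<- /IH hb]]]]]].
by have := g_step hx; rewrite chain_pt0; lia.
Qed.

Lemma reach_mono N N' x c : N <= N' -> reach N x c -> reach N' x c.
Proof.
elim: N' => [|N' IH] hN hE; first by move: hE; have -> : N = 0 by lia.
by case: (ltngtP N N'.+1) hN => // [lt_N _|EN _]; [left; apply: IH|rewrite -EN].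
Qed.

Lemma reach_singles l N x :
  can_step_upto x l -> reach N (chain_pt x l) (g (chain_pt x l)) -> reach (l + N) x (g x).
Proof.
elim: l x => [|l IH] x hok; first by rewrite chain_pt0.
have h0 : can_step x 0 by apply: hok.
have h1 : can_step_upto x 1 by move=> k hk; have -> : k = 0 by lia.
have := IH (chain_pt x 1); rewrite chain_pt_add // add1n => H hE /=; right; right; split=> //.
have gx := g_step h0; rewrite chain_pt0 in gx.
exists (h (chain_base x 0)); split; first (have := @gB x; have := @gB (chain_pt x 1); lia).
split=> //; have -> : (g x - h (chain_base x 0) = g (chain_pt x 1))%Z by lia.
by apply: H => // k hk; apply/(can_step_add _ h1); apply: hok; lia.
Qed.

Definition pad (w : vec n) : env := vapp w (fun => 0).

Definition sign_at (l : form) (w : vec n) : bool := Z.ltb 0 (ev l (pad w)).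

(** Along a chain every form is an affine function of the step, so its sign changes at most once. *)
Lemma lin_affine a (e e' u v : env) k :
  (forall i, e' i + u i * k = e i + v i * k) ->
  (lin a e' = lin a e + k%:z * (lin a v - lin a u))%Z.
Proof.
elim: a e e' u v => [|b a IH] e e' u v H /=; first by lia.
have := IH (fun i => e i.+1) (fun i => e' i.+1) (fun i => u i.+1) (fun i => v i.+1) (fun i => H i.+1).
have := H 0; set A := lin a _; set A' := lin a _; nia.
Qed.

Lemma vapp_rel (w w' : vec n) (F : nat -> nat -> nat -> nat -> Prop) :
  (forall i, F (w' i) (p i) (w i) (q i)) -> F 0 0 0 0 ->
  forall i, F (pad w' i) (pad p i) (pad w i) (pad q i).
Proof. by move=> H H0 i; rewrite /pad /vapp; case: insubP. Qed.

Lemma ev_chain l x k : can_step x 0 -> can_step x k ->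
  (ev l (pad (chain_base x k)) = ev l (pad (chain_base x 0)) +
     k%:z * (lin l.2 (pad q) - lin l.2 (pad p)))%Z.
Proof.
move=> h0 hk; rewrite /ev (@lin_affine l.2 (pad (chain_base x 0)) (pad (chain_base x k))
  (pad p) (pad q) k); first by lia.
apply: (vapp_rel (F := fun a b c d => a + b * k = c + d * k)) => // i.
by have := h0 i; have := hk i; rewrite /chain_base; lia.
Qed.

Lemma sign_between l x k N :
  can_step_upto x N.+1 -> k <= N -> sign_at l (chain_base x 0) = sign_at l (chain_base x N) ->
  sign_at l (chain_base x k) = sign_at l (chain_base x 0).
Proof.
move=> hok le_kN; rewrite /sign_at.
rewrite (ev_chain l (hok 0 _) (hok k _)) // (ev_chain l (hok 0 _) (hok N _)) //.
move: (ev _ _) (_ - _)%Z => a b E.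
have kb : (0 <= k%:z * b <= N%:z * b \/ N%:z * b <= k%:z * b <= 0)%Z.
  have : (0 <= k%:z <= N%:z)%Z by lia.
  move: (k%:z) (N%:z) => u v huv.
  by case: (Z.le_ge_cases 0 b) => hb; [left|right]; split; nia.
move: E kb; move: (k%:z * b)%Z (N%:z * b)%Z => u v.
case: (Z.ltb_spec 0 a) => h1; case: (Z.ltb_spec 0 (a + v)) => h2 // _ kb;
  case: (Z.ltb_spec 0 (a + u)) => h3 //; lia.
Qed.

(** [m] steps do not change residues modulo [m], so [h] is [m]-periodic while the signs of the
    forms are constant. *)
Lemma h_periodic x k : can_step x 0 -> can_step x k -> can_step x (k + m) ->
  (forall l, List.In l L -> sign_at l (chain_base x k) = sign_at l (chain_base x (k + m))) ->
  h (chain_base x k) = h (chain_base x (k + m)).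
Proof.
move=> h0 h1 h2 hs.
rewrite -(vapp_l (chain_base x k) (fun => 0)) -(vapp_l (chain_base x (k + m)) (fun => 0)) -/(pad _) -/(pad _).
apply: hinv; split=> [l /hs|i].
  by rewrite /sign_at => E; split; move/Z.ltb_lt; [rewrite E|rewrite -E]; move/Z.ltb_lt.
rewrite /cong /pad /vapp; case: insubP => [j _ _|_]; last by exists 0%Z; lia.
exists ((p j)%:z - (q j)%:z)%Z.
by have := h1 j; have := h2 j; rewrite /chain_base; lia.
Qed.

Lemma chain_ends x : exists N, can_step_upto x N /\ ~ can_step x N.
Proof.
have [] := @ex_least (fun k => ~ can_step x k).
  by exists (x i0).+1 => /(_ i0); nia.
by move=> N [h1 h2]; exists N; split=> // k /h2 /NNPP.
Qed.

Lemma count_lt (T : Type) (a b : pred T) s : (forall x, a x -> b x) ->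
  (exists x, List.In x s /\ b x /\ ~~ a x) -> count a s < count b s.
Proof.
move=> ab; elim: s => [|y s IH] [x [//= [->|hx] [bx ax]]].
  by rewrite bx (negbTE ax) ltnS; apply: sub_count.
by have := IH (ex_intro _ x (conj hx (conj bx ax))); have := ab y;
  case: (a y) => [/(_ isT) ->|_] //=; lia.
Qed.

(** Either at most [2 * (B + 1) * m] single steps, or one jump and fewer than [m] single steps. *)
Definition stretch_cost := 2 * B.+1 * m + m + 1.

Lemma reach_stretch l N x : can_step_upto x l ->
  (forall k, k < l -> forall f, List.In f L -> sign_at f (chain_base x k) = sign_at f (chain_base x 0)) ->
  reach N (chain_pt x l) (g (chain_pt x l)) -> reach (stretch_cost + N) x (g x).
Proof.
move=> hok hs hE.
case: (leqP l (2 * B.+1 * m)) => hl.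
  by apply: reach_mono (reach_singles hok hE); rewrite /stretch_cost; lia.
pose j := l %/ m; pose r := l %% m.
have El : l = m * j + r by rewrite /j /r mulnC -divn_eq.
have hr : r < m by rewrite ltn_mod.
have hj : 2 * B < j.
  by rewrite leq_divRL //; nia.
have hokj : can_step_upto x (m * j) by move=> k hk; apply: hok; lia.
have Hy : reach (r + N) (chain_pt x (m * j)) (g (chain_pt x (m * j))).
  apply: reach_singles; last by rewrite chain_pt_add // -El.
  by move=> k hk; apply/(can_step_add _ hokj); apply: hok; lia.
have hjump : jump x (chain_pt x (m * j)).
  exists j; do 3 split=> //; move=> k hk.
  apply: h_periodic; try (apply: hok; lia).
  by move=> f hf; rewrite !hs //; lia.
apply: (@reach_mono (r + N).+1); first by rewrite /stretch_cost; lia.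
by right; left; exists (chain_pt x (m * j)); rewrite (jump_g hjump).
Qed.

(** Along a chain each form changes sign at most once, and every stretch but the last ends with
    such a change; the forms that still have to change their sign are counted. *)
Lemma reach_complete : exists N, forall x, reach N x (g x).
Proof.
exists (stretch_cost * (size L).+1).
suff H N : forall x, can_step_upto x N -> ~ can_step x N ->
    reach (stretch_cost * (count (fun l => sign_at l (chain_base x 0) != sign_at l (chain_base x N.-1)) L).+1) x (g x).
  move=> x; have [N [h1 h2]] := chain_ends x.
  by apply: reach_mono (H N x h1 h2); rewrite leq_mul2l ltnS count_size orbT.
elim/ltn_ind: N => N IH x hok hend.
case: N => [|N] in IH hok hend *.
  by apply: (@reach_mono 0) => //; split.
(* The first stretch ends at [l]. *)
have [l [hl hlmin]] := @ex_least (fun k => k = N.+1 \/ exists f, List.In f L /\ sign_at f (chain_base x k) <> sign_at f (chain_base x 0))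
   (ex_intro _ N.+1 (or_introl erefl)).
have l0 : 0 < l by case: l hl {hlmin} => // -[//|[f []]].
have le_l : l <= N.+1.
  by rewrite leqNgt; apply/negP => /hlmin; apply; left.
have hokl : can_step_upto x l by move=> k hk; apply: hok; lia.
have hs k : k < l -> forall f, List.In f L -> sign_at f (chain_base x k) = sign_at f (chain_base x 0).
  by move=> hk f hf; apply: NNPP => hne; apply: (hlmin k hk); right; exists f.
case: (ltngtP l N.+1) le_l => // [lt_l _|El _]; last first.
  apply: (@reach_mono (stretch_cost + 0)); first by rewrite /stretch_cost; nia.
  apply: (reach_stretch hokl hs); split=> //; rewrite El in hokl *.
  by move/(can_step_add _ hokl); rewrite addn0.
have := IH (N.+1 - l) ltac:(lia) (chain_pt x l).
have hok' : can_step_upto (chain_pt x l) (N.+1 - l) by move=> k hk; apply/(can_step_add _ hokl); apply: hok; lia.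
have hend' : ~ can_step (chain_pt x l) (N.+1 - l) by move/(can_step_add _ hokl); rewrite subnKC // ltnW.
move=> /(_ hok' hend') HE.
apply: reach_mono (reach_stretch hokl hs HE).
rewrite -mulnS leq_mul2l ltnS; apply/orP; right.
rewrite !chain_base_add // addn0 (_ : l + (N.+1 - l).-1 = N); last by lia.
case: hl => [?|[f [hf hne]]]; first by lia.
apply: count_lt => [k|].
  apply: contra => /eqP Ek.
  by rewrite (sign_between hok lt_l Ek) Ek.
exists f; split=> //.
have ne : sign_at f (chain_base x 0) != sign_at f (chain_base x N).
  by apply/eqP => Ef; apply: hne; apply: (sign_between hok) => //; lia.
split=> //; rewrite negbK.
by case: (sign_at f (chain_base x l)) hne ne; case: (sign_at f (chain_base x 0)); case: (sign_at f (chain_base x N)).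
Qed.

(** Each [reach N] is definable, and one [N] serves for all points. *)
Lemma integration_core : presburger_levels g.
Proof.
have [N HN] := reach_complete => c.
suff H : presburger (fun x => reach N x c).
  by apply: presb_ext H => x; split=> [/reach_sound //|<-].
elim: N c {HN} => [|N IH] c.
  apply: (@presb_ext _ (fun x => exists i, x i < p i /\ g x = c)).
    move=> x; split=> [[i [h1 h2]]|/= [h1 h2]].
      by split=> // /(_ i); lia.
    have /not_all_ex_not [i hi] := h1.
    by exists i; split=> //; move/negP: hi; lia.
  apply: def_exI => i.
  apply: (@def_ext _ (fun _ e => exists v : 'I_(p i), e i = v /\ g (fun i : 'I_n => e i) = c)).
    move=> S e; split=> [[v [-> h2]]|[h1 h2]]; first by [].
    by exists (Ordinal h1).
  by apply: def_exI => v; apply: hg.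
have hB x : (Z.abs (h x) <= (2 * B)%N%:z)%Z.
  by rewrite /h /difference; have := @gB (vadd x p); have := @gB (vadd x q); lia.
have hz (r : 'I_n -> nat) t c' : definable_fun t -> definable (fun (S : structure voc_add_lt) e =>
    h (fun i => e (r i) + q i * t S e - (p i + p i * t S e)) = c').
  move=> ht.
  apply: (presb_subst (t := fun i S e => e (r i) + q i * t S e - (p i + p i * t S e)) (hh c')).
  by move=> i; apply: tdef_sub; sdef.
have hx0 : definable (fun (_ : structure voc_add_lt) (e : env) => can_step (fun i : 'I_n => e i) 0).
  by rewrite /can_step; sdef.
have h2 : definable (fun (_ : structure voc_add_lt) e =>
    exists y : vec n, jump (fun i : 'I_n => e i) y /\ reach N y c).
  sdef; last exact: (IH c).
  rewrite /jump /can_step_upto /can_step /chain_pt /chain_base; sdef.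
  - by apply: tdef_sub; sdef.
  - apply: (@def_ext _ (fun _ e => exists b, (Z.abs b <= (2 * B)%N%:z)%Z /\
     (h (fun i => e (n + i).+2 + q i * e 0 - (p i + p i * e 0)) = b /\
      h (fun i => e (n + i).+2 + q i * (e 0 + m) - (p i + p i * (e 0 + m))) = b))).
      move=> S e; split=> [[b [_ [-> ->]]] //|E0].
      by exists (h (fun i => e (n + i).+2 + q i * e 0 - (p i + p i * e 0))).
    by apply: def_exZ => b; apply: def_and; apply: hz; sdef.
apply: (def_or (IH c) (def_or h2 (def_and hx0 _))).
apply: def_exZ => b; apply: def_and; first by apply: (hz (fun i => i)); sdef.
apply: (presb_subst (t := fun i _ e => e i + q i * 1 - p i * 1) (IH (c - b)%Z)) => i.
by apply: tdef_sub; sdef.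
Qed.
End Integration.

(** * Difference operators and the main induction *)

(** Exchanging [p] and [q] changes the sign of the difference, so [p] may be assumed to exceed [q]
    in some coordinate. *)
Lemma integration n (g : vec n -> Z) (p q : vec n) (i0 : 'I_n) : p i0 <> q i0 ->
  boundedZ g -> presburger_sections g -> presburger_levels (difference p q g) -> presburger_levels g.
Proof.
move=> neq; wlog lt_qp : p q neq / q i0 < p i0.
  move=> H hB hs hl; case: (ltngtP (q i0) (p i0)) => [lt|lt|E]; last by case: neq.
    exact: (H p q).
  apply: (H q p) => //; first by move=> E; apply: neq.
  move=> c; apply: presb_ext (hl (- c)%Z) => x; rewrite /difference; lia.
move=> hB hs hl; case: (hB) => B HB.
have [L [m [m0 hinv]]] := levels_inv (boundedZ_diff p q hB) hl.
apply: (@integration_core _ g p q (Z.to_nat B) i0 _ lt_qp hl hs L m m0 hinv).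
by move=> x; have := HB x; lia.
Qed.

Section Differences.
Variables n s : nat.

Definition small := {ffun 'I_n -> 'I_s.+1}.
Definition svec (a : small) : vec n := fun i => a i.

Definition diffs (l : seq (small * small)) (g : vec n -> Z) : vec n -> Z :=
  foldl (fun g ab => difference (svec ab.1) (svec ab.2) g) g l.

Lemma levels_of_diffs l g : all (fun ab => ab.1 != ab.2) l ->
  boundedZ g -> presburger_sections g -> presburger_levels (diffs l g) -> presburger_levels g.
Proof.
elim: l g => //= -[a b] l IH g /= /andP [neq hl] hB hs hd.
have : exists i, a i <> b i.
  apply: NNPP => H; move/eqP: neq; apply; apply/ffunP => i.
  by apply: NNPP => hi; apply: H; exists i.
case=> i hi; apply: (integration (p := svec a) (q := svec b) (i0 := i)) => //.
  by move=> E; apply: hi; apply: val_inj.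
by apply: IH => //; [apply: boundedZ_diff|apply: sections_diff].
Qed.

Lemma svec_le (a : small) i : svec a i <= s.
Proof. by rewrite -ltnS ltn_ord. Qed.

Lemma diffs_zero l g x : (forall z : vec n, (forall i, z i <= s * size l) -> g (vadd x z) = 0%Z) ->
  diffs l g x = 0%Z.
Proof.
elim: l g => [|[a b] l IH] g /= H.
  rewrite -(H (fun => 0)) //; congr g; apply: functional_extensionality => i.
  by rewrite /vadd addn0.
apply: IH => z hz; rewrite /difference.
have E (c : small) : vadd (vadd x z) (svec c) = vadd x (vadd z (svec c)).
  by apply: functional_extensionality => i; rewrite /vadd addnA.
have hle (c : small) i : vadd z (svec c) i <= s * (size l).+1.
  by rewrite /vadd mulnS addnC leq_add // svec_le.
by rewrite !E (H _ (hle a)) (H _ (hle b)).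
Qed.

(** Difference operators commute, so one of them may be applied first; the others only look at
    points at distance at most [s * size l]. *)
Lemma diffs_vanish l g x (a b : small) : (a, b) \in l ->
  (forall z : vec n, (forall i, z i <= s * size l) -> difference (svec a) (svec b) g (vadd x z) = 0%Z) ->
  diffs l g x = 0%Z.
Proof.
elim: l g => [//|[a' b'] l IH] g; rewrite inE => /orP [/eqP [<- <-]|hin] /= H.
  by apply: diffs_zero => z hz; apply: H => i; apply: leq_trans (hz i) _; rewrite leq_mul2l leqnSn orbT.
apply: IH => // z hz.
have E c c' : vadd (vadd (vadd x z) c) c' = vadd (vadd x (vadd z c')) c.
  by apply: functional_extensionality => i; rewrite /vadd; lia.
have hle (c : small) i : vadd z (svec c) i <= s * (size l).+1.
  by rewrite /vadd mulnS addnC leq_add // svec_le.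
have := H _ (hle a'); have := H _ (hle b'); rewrite /difference !E; lia.
Qed.
End Differences.

Lemma levels_finite n (g : vec n -> Z) b :
  (forall x, g x <> 0%Z -> vnorm x <= b) -> presburger_levels g.
Proof.
move=> hg c.
apply: (@def_ext _ (fun _ e =>
  (exists a : {ffun 'I_n -> 'I_b.+1}, g (svec a) = c /\ forall i : 'I_n, e i = svec a i) \/
  (c = 0%Z /\ ~ forall i : 'I_n, e i <= b))).
  move=> S e; split=> [[[a [<- h]]|[-> /vnorm_leP h]]|h].
  - by congr g; apply: functional_extensionality.
  - by apply: NNPP => /hg.
  case: (classic (forall i : 'I_n, e i <= b)) => hle; [left|right].
    pose a : small n b := [ffun i : 'I_n => inord (e i)]; exists a.
    have E : svec a = (fun i : 'I_n => e i).
      by apply: functional_extensionality => i; rewrite /svec ffunE inordK // ltnS.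
    by rewrite E.
  by split=> //; rewrite -h; apply: NNPP => /hg /vnorm_leP.
apply: def_or; last by sdef.
by apply: def_exF => a; sdef.
Qed.

(** An integer function, since differences are to be taken. *)
Definition indicator n (R : vec n -> Prop) (x : vec n) : Z :=
  if excluded_middle_informative (R x) then 1%Z else 0%Z.

Lemma indicator1 n (R : vec n -> Prop) x : indicator R x = 1%Z <-> R x.
Proof. by rewrite /indicator; case: excluded_middle_informative. Qed.

Lemma indicator_eq n (R : vec n -> Prop) x y : (R x <-> R y) -> indicator R x = indicator R y.
Proof.
move=> h; rewrite /indicator.
by case: excluded_middle_informative => h1; case: excluded_middle_informative => h2 //; exfalso; tauto.
Qed.

(** Where the box of side [s + s * size l] has a period of size at most [s], one of the difference
    operators annihilates the indicator function nearby, hence so does their composition. *)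
Lemma presb_of_locally_periodic n (R : vec n -> Prop) s :
  (forall i v, presburger (fun x => x i = v /\ R x)) ->
  (forall k, bounded (aperiodic R s k)) -> presburger R.
Proof.
move=> hsec hper; pose f := indicator R.
apply: (@presb_ext _ (fun x => f x = 1%Z)) => [x|]; first exact: indicator1.
pose l : seq (small n s * small n s) := [seq ab <- enum {: small n s * small n s} | ab.1 != ab.2].
have [b hb] := hper (s + s * size l).
apply: (@levels_of_diffs _ _ l).
- exact: filter_all.
- by exists 1%Z => x; rewrite /f /indicator; case: excluded_middle_informative => h /=; lia.
- move=> i v c.
  apply: (@def_ext _ (fun _ e => (c = 1%Z /\ (e i = v /\ R (fun j : 'I_n => e j))) \/
     (c = 0%Z /\ (e i = v /\ ~ (e i = v /\ R (fun j : 'I_n => e j)))))).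
    move=> S e; rewrite /f /indicator; case: excluded_middle_informative => h.
      by split=> [[[-> [-> _]]|[_ [E []]]]|[-> <-]] //; left.
    by split=> [[[_ [_ /h]]|[-> [-> _]]]|[-> <-]] //; right; split=> //; split=> // -[].
  have hi := hsec i v; rewrite /presburger /definable_vec in hi.
  by apply: def_or; (apply: def_and; first exact: def_Prop) => //; apply: def_and; sdef;
    try exact: hi; apply: def_not.
apply: (@levels_finite _ _ b) => x hx; apply: hb => p q hp hq neq; apply: NNPP => H.
apply: hx; pose a (r : vec n) : small n s := [ffun i => inord (r i)].
have Ea (r : vec n) : (forall i, r i <= s) -> svec (a r) = r.
  by move=> hr; apply: functional_extensionality => i; rewrite /svec ffunE inordK // ltnS.
apply: (@diffs_vanish _ _ l f x (a p) (a q)).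
  rewrite mem_filter mem_enum andbT /=; apply/eqP => E; apply: neq => i.
  by rewrite -(Ea p hp) -(Ea q hq) E.
move=> z hz; rewrite /difference (Ea p hp) (Ea q hq).
suff -> : f (vadd (vadd x z) p) = f (vadd (vadd x z) q) by lia.
apply: indicator_eq; apply: NNPP => hne; apply: H.
exists (vadd (vadd x z) q); split.
  split=> i; rewrite /vadd; first by rewrite -addnA leq_addr.
  by rewrite -addnA leq_add2l addnC leq_add.
exists (vadd (vadd x z) p); split; first by move=> i; rewrite /vadd; lia.
by move=> h; apply: hne; tauto.
Qed.

Definition insert n (i : 'I_n.+1) v (x : vec n) : vec n.+1 :=
  fun j => if unlift i j is Some k then x k else v.

Lemma presb_section n (R : vec n.+1 -> Prop) i v :
  presburger (fun x : vec n => R (insert i v x)) -> presburger (fun x => x i = v /\ R x).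
Proof.
move=> h.
apply: (@def_ext _ (fun _ e => e i = v /\ R (insert i v (fun k : 'I_n => e (lift i k))))).
  move=> S e; suff E : e i = v -> insert i v (fun k : 'I_n => e (lift i k)) = fun j : 'I_n.+1 => e j.
    by split=> -[h1]; rewrite (E h1).
  move=> Ei; apply: functional_extensionality => j; rewrite /insert.
  by case: unliftP => [k ->|->].
apply: def_and; first by sdef.
exact: (@fdef_ren _ _ (fun _ _ x => R (insert i v x)) (fun i => i) (fun k : 'I_n => lift i k)).
Qed.

(** The value of the fixed coordinate is a parameter of the section, stored first. *)
Lemma forced_presb V n (F : structure V -> env -> vec n -> Prop) : definable_vec F ->
  forced (fun S => forall e, presburger (F S e)).
Proof.
elim: n F => [|n IH] F hF.
  apply: forced_True => S e.
  apply: (@presb_ext _ (fun _ => F S e (fun _ => 0))) => [x|]; last exact: def_Prop.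
  suff -> : x = fun _ => 0 by [].
  by apply: functional_extensionality => -[].
have hsec (i : 'I_n.+1) : forced (fun S => forall e, presburger (fun x => F S (fun j => e j.+1) (insert i (e 0) x))).
  apply: (IH (fun S e x => F S (fun j => e j.+1) (insert i (e 0) x))).
  (* The variable with index [n], the first parameter, holds the value of coordinate [i]. *)
  pose r (j : 'I_n.+1) : nat := if unlift i j is Some k then k else n.
  apply: def_ext (fdef_ren (fun j => n + j.+1) r hF) => S e.
  suff -> : (fun j => e (r j)) = insert i (e (n + 0)) (fun k : 'I_n => e k) by [].
  apply: functional_extensionality => j; rewrite /r /insert addn0.
  by case: unlift.
apply: forced_weaken (forced_and (forced_allI hsec) (locally_periodic hF)).
move=> S [hS [s hs]] e; apply: (@presb_of_locally_periodic _ _ s) => [i v|k]; last exact: hs.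
by apply: presb_section; apply: (hS i (scons v e)).
Qed.

Theorem theorem4p3 (d : nat) (hd : 1 <= d) :
  exists nu : formula (voc_add_lt_rel d) 1,
    forall S : structure (voc_add_lt_rel d),
      ~ @FO_add_lt_definable d (S tt) ->
      ~ ultimately_periodic (fun n : nat => defined_set S nu [tuple n]) /\
      ~ FO_add_lt_definable (defined_set S nu).
Proof.
pose F (S : structure (voc_add_lt_rel d)) (_ : env) (x : vec d) := S tt [tuple x i | i < d].
have hF : definable_vec F.
  exists d, (@Rel (voc_add_lt_rel d) d tt [tuple Var i | i < d]) => S e /=.
  suff -> : map_tuple (eval (restrict d e)) [tuple Var i | i < d] = [tuple e i | i < d] by [].
  by apply: eq_from_tnth => i; rewrite tnth_map !tnth_mktuple /= tnth_mktuple.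
have [nu Hnu] := forced_uniform (forced_presb hF).
exists nu => S ndef.
have nUP : ~ ultimately_periodic (fun n => defined_set S nu [tuple n]).
  move=> /Hnu /(_ (fun => 0)) [m [phi hphi]]; apply: ndef.
  pose f i : 'I_d := insubd (Ordinal hd) i.
  exists (fren phi (fun i => f i)) => v; rewrite /defined_set sat_fren.
  have -> : [tuple tnth v (f i) | i < m] = restrict m (fun i => tnth v (f i)).
    by apply: eq_from_tnth => i; rewrite !tnth_mktuple.
  rewrite hphi /F; set u := [tuple _ | _ < _]; suff -> : u = v by [].
  by apply: eq_from_tnth => i; rewrite tnth_mktuple /f valKd.
by split=> // /definable_UP.
Qed.
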